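(* Let $T>0$ and $a>0$. Assume the following. (i) $\Phi:[-a,a]\to\mathbb{R}$ satisfies $\Phi\in C[-a,a]\cap C^1(-a,a)$, and $\phi:=\Phi':(-a,a)\to\mathbb{R}$ is an increasing homeomorphism (onto $\mathbb{R}$) with $\phi(0)=0$. (ii) $f:[0,T]\times\mathbb{R}\to\mathbb{R}$ is continuous, $\lim_{|s|\to+\infty}f(t,s)=0$ uniformly with respect to $t\in[0,T]$, and there exists $\alpha\in\mathbb{R}$ such that the primitive $F(t,\tau)=\int_0^\tau f(t,s)\,ds$ satisfies $\lim_{|s|\to+\infty}F(t,s)=\alpha$ uniformly with respect to $t\in[0,T]$. (iii) $h:[0,T]\to\mathbb{R}$ is continuous and $\int_0^T h(t)\,dt=0$. Let $\tilde w\in W\cap K$ be such that $J(\tilde w)=\min_{\tilde v\in W}J(\tilde v)$. If there exists $\bar v_0\in\mathbb{R}$ such that $$\int_0^T F(t,\tilde w(t)+\bar v_0)\,dt\le\alpha T,$$ then the functional $I$ has a minimum, i.e. $I$ attains its infimum over $W^{1,\infty}_{\#}(0,T)$.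
   Context: $W^{1,\infty}_{\#}(0,T)$ is the Sobolev space of $T$-periodic functions $u$ (i.e. $u\in W^{1,\infty}(0,T)$ with $u(0)=u(T)$) such that $u$ and its distributional derivative $u'$ are bounded, with norm $\|u\|_{W^{1,\infty}_{\#}}=\|u\|_\infty+\|u'\|_\infty$. $K=\{v\in W^{1,\infty}_{\#}(0,T):\|v'\|_\infty\le a\}$. $W=\{v\in W^{1,\infty}_{\#}(0,T):\int_0^T v\,dt=0\}$. The functionals $J,I:W^{1,\infty}_{\#}(0,T)\to\mathbb{R}\cup\{+\infty\}$ are $$J(v)=\begin{cases}\int_0^T[\Phi(v')+h(t)v]\,dt, & v\in K,\\ +\infty, & v\notin K,\end{cases}\qquad I(v)=\begin{cases}\int_0^T[\Phi(v')+h(t)v+F(t,v)]\,dt, & v\in K,\\ +\infty, & v\notin K.\end{cases}$$ A minimizer $\tilde w\in W\cap K$ of $J$ over $W$ exists under the stated hypotheses. *)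

(* Defs.v *)
From HB Require Import structures.
From mathcomp Require Import all_boot all_order all_algebra.
From mathcomp Require Import all_classical all_reals all_analysis.

Set Implicit Arguments.
Unset Strict Implicit.
Unset Printing Implicit Defensive.

Import Order.TTheory GRing.Theory Num.Theory.
Import numFieldNormedType.Exports.

Local Open Scope classical_set_scope.
Local Open Scope ring_scope.

Section Sobolev.
Context {R : realType}.
Notation mu := (@lebesgue_measure R).
Implicit Types (T a : R) (u v g p : R -> R).

Definition linf_norm T u : \bar R :=
  Lnorm mu +oo%E (EFin \o (u \_ `]0, T[)).

Definition in_linf T u : Prop :=
  measurable_fun `]0, T[ u /\ (linf_norm T u < +oo)%E.

Definition test_function T p : Prop :=
  [/\ forall n x, derivable (derive1n n p) x 1,
      compact (closure [set x | p x != 0]) &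
      closure [set x | p x != 0] `<=` `]0, T[].

Definition is_weak_derivative T u g : Prop :=
  forall p, test_function T p ->
    \int[mu]_(t in `]0, T[) (u t * derive1 p t) =
    - \int[mu]_(t in `]0, T[) (g t * p t).

(* Elements of W^{1,oo}_#(0,T) are represented by functions on R of which only
   the restriction to [0, T] matters.  The trace condition u 0 = u T refers to
   the continuous representative of u, hence the continuity requirement. *)
Definition W1inf_per T : set (R -> R) :=
  [set u | [/\ {within `[0, T], continuous u}, in_linf T u,
               exists g, in_linf T g /\ is_weak_derivative T u g &
               u 0 = u T]].

(* Weak derivatives agree almost everywhere on ]0, T[, so neither the norm nor
   the integrals below depend on the representative that is chosen here. *)
Definition weak_derivative T u : R -> R :=
  xget (cst 0) [set g | in_linf T g /\ is_weak_derivative T u g].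

Definition setK T a : set (R -> R) :=
  [set v | W1inf_per T v /\ (linf_norm T (weak_derivative T v) <= a%:E)%E].

Definition setW T : set (R -> R) :=
  [set v | W1inf_per T v /\ \int[mu]_(t in `[0, T]) v t = 0].

(* Oriented integral of f t from 0 to s. *)
Definition primitive (f : R -> R -> R) (t s : R) : R :=
  if 0 <= s then \int[mu]_(x in `[0, s]) f t x
  else - \int[mu]_(x in `[s, 0]) f t x.

Definition functionalJ T a (Phi h : R -> R) v : \bar R :=
  if `[< setK T a v >] then
    (\int[mu]_(t in `[0%R, T])
       (Phi (weak_derivative T v t) + h t * v t)%R%:E)%E
  else +oo%E.

Definition functionalI T a (Phi h : R -> R) (f : R -> R -> R) v : \bar R :=
  if `[< setK T a v >] then
    (\int[mu]_(t in `[0%R, T])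
       (Phi (weak_derivative T v t) + h t * v t
        + primitive f t (v t))%R%:E)%E
  else +oo%E.

Definition is_minimizer (J : (R -> R) -> \bar R) (A : set (R -> R)) u : Prop :=
  A u /\ forall v, A v -> (J u <= J v)%E.

Definition lim_infty_unif T (f : R -> R -> R) (l : R) : Prop :=
  forall e, 0 < e -> exists M : R, forall t s,
    t \in `[0, T] -> M < `|s| -> `|f t s - l| < e.

Definition homeomorphism_onto_R (A : set R) (f : R -> R) : Prop :=
  {within A, continuous f} /\
  exists g : R -> R, [/\ continuous g, forall y, A (g y),
    forall x, A x -> g (f x) = x & forall y, f (g y) = y].

End Sobolev.

(* Main.v *)
Require Import Defs.
From HB Require Import structures.
From mathcomp Require Import all_boot all_order all_algebra.
From mathcomp Require Import all_classical all_reals all_analysis.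
From mathcomp Require Import measurable_realfun ess_sup_inf lebesgue_integral_under.
From mathcomp Require Import ring lra.

(** The direct method, with two possible sources for the minimizer.

    Write an element of K as v = v 0 + \int_0^t g with g measurable, |g| <= a and
    \int_0^T g = 0; then I v = E g + \int h v + \int F(t, v), where
    E g = \int Phi(g).  Since h has mean zero, E g + \int h v does not change
    when a constant is added to v, so it is at least J w ([constrained_minimum]).

    If |v 0| is large then |v| is large on the whole of [0, T], because v is
    a-Lipschitz, and \int F(t, v) is close to alpha T.  Hence
    I v >= J w + alpha T - e as soon as |v 0| is large enough ([coercivity]), and
    J w + alpha T >= I (w + v0) by the hypothesis on v0.  So either w + v0 minimizes
    I, or some v1 has I v1 < I (w + v0), and then every competitor with |v 0| large is
    worse than v1: it is enough to minimize over |v 0| <= M ([bounded_minimum]).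

    On that set a minimizing sequence is bounded and equi-Lipschitz, so it has a
    uniform cluster point V ([uniform_cluster_lipschitz]), along which the terms in h
    and F converge.  For the term E, [weak_lower_semicontinuity] produces a
    derivative of V that does at least as well as the limit value: for each r > 0 the
    functions g with |g| <= a, E g <= e + r and primitive r-close to V form a set that
    is stable under midpoints, because Phi is convex; almost minimizers of the
    L^2 norm on these nested sets form a Cauchy sequence by the parallelogram
    identity, and their almost everywhere limit is the derivative that is sought.

    The passage between weak derivatives and primitives rests on an explicit smooth
    bump: from it come test functions whose derivative is a difference of two
    approximate Dirac masses, which give [du_bois_reymond]; Fubini's theorem shows
    conversely that a primitive has the expected weak derivative
    ([indefinite_by_parts]).  Both are combined in [setK_integral_rep] and
    [integral_setK]. *)

Set Implicit Arguments.
Unset Strict Implicit.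
Unset Printing Implicit Defensive.

Import Order.TTheory GRing.Theory Num.Theory.
Import numFieldNormedType.Exports.

Local Open Scope classical_set_scope.
Local Open Scope ring_scope.

(** * A smooth bump on the unit interval *)

Section SmoothBump.
Context {R : realType}.
Implicit Types (P Q : {poly R}) (f g : R -> R).

(** The family P(1/x) e^(-1/x), extended by 0 to the left of the origin, is stable
    under differentiation, so that smoothness needs no formula for the n-th
    derivative. *)
Definition flat P (x : R) : R :=
  if 0 < x then P.[x^-1] * expR (- x^-1) else 0.

Lemma is_derive0_quadratic f (C : R) :
    (forall h, `|h| <= 1 -> `|f h| <= C * h ^+ 2) ->
  is_derive (0 : R) 1 f 0.
Proof.
move=> fC.
have f0 : f 0 = 0.
  have := fC 0; rewrite normr0 expr0n/= mulr0 ler01 => /(_ isT).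
  by rewrite normr_le0 => /eqP.
have C0 : 0 <= C.
  have := fC 1; rewrite normr1 lexx expr1n mulr1 => /(_ isT).
  by apply: le_trans.
have cf : h^-1 *: ((f \o shift (0 : R)) (h *: 1) - f 0) @[h --> 0^'] --> (0 : R).
  apply/cvgrPdist_le => /= e e0.
  have d0 : 0 < Num.min 1 (e / (C + 1)).
    by rewrite lt_min ltr01 divr_gt0// ltr_wpDl.
  near=> h.
  have hn : h != 0 by near: h; exact: nbhs_dnbhs_neq.
  have : `|h| < Num.min 1 (e / (C + 1)).
    by near: h; apply: dnbhs0_lt.
  rewrite lt_min => /andP[/ltW h1].
  rewrite ltr_pdivlMr ?ltr_wpDl// => he.
  rewrite sub0r normrN /= addr0 f0 subr0 /GRing.scale/= mulr1 normrM normfV.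
  rewrite ler_pdivrMl ?normr_gt0//.
  apply: (le_trans (fC _ h1)).
  rewrite -real_normK ?num_real// expr2 mulrA mulrC ler_wpM2l//.
  rewrite mulrC (le_trans _ (ltW he))// ler_wpM2l// lerDl//.
split; first by apply/cvg_ex; exists 0; exact: cf.
by apply/cvg_lim => //; exact: cf.
Unshelve. all: by end_near. Qed.

Lemma horner_le_pow P : exists n C, forall y : R, 1 <= y -> `|P.[y]| <= C * y ^+ n.
Proof.
elim/poly_ind: P => [|P c [n [C PC]]].
  by exists 0%N, 0 => y _; rewrite horner0 normr0 mul0r.
exists n.+1, (C + `|c|) => y y1.
have y0 : 0 <= y by rewrite (le_trans ler01).
rewrite hornerMXaddC (le_trans (ler_normD _ _))// mulrDl lerD//.
  by rewrite normrM (ger0_norm y0) exprSr mulrA ler_wpM2r// PC.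
by rewrite ler_peMr// exprn_ege1.
Qed.

(** The exponential beats every power of 1/x; the factor h^2 that is left over makes
    the derivative at the origin vanish, by [is_derive0_quadratic]. *)
Lemma flat_quadratic P : exists C, forall h, `|h| <= 1 -> `|flat P h| <= C * h ^+ 2.
Proof.
have [n [C PC]] := horner_le_pow P.
exists (`|C| * (n.+2)`!%:R) => h h1; rewrite /flat; case: ifPn => h0; last first.
  by rewrite normr0 mulr_ge0 ?sqr_ge0 ?mulr_ge0 ?ler0n.
have y1 : 1 <= h^-1 by rewrite invf_ge1// (le_trans (ler_norm _)).
have y0 : 0 < h^-1 by rewrite invr_gt0.
rewrite normrM (ger0_norm (expR_ge0 _)).
have := PC _ y1 => Py.
have ey : expR (- h^-1) <= (n.+2)`!%:R * h ^+ n.+2.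
  rewrite expRN -[leRHS]invrK lef_pV2 ?posrE ?expR_gt0//; last first.
    by rewrite invr_gt0 mulr_gt0// ?ltr0n ?fact_gt0// exprn_gt0.
  have := @expR_ge1Dxn R h^-1 n.+1 (ltW y0).
  rewrite invfM -exprVn mulrC; apply: le_trans.
  by rewrite lerDr.
apply: (le_trans (ler_pM (normr_ge0 _) (expR_ge0 _) Py ey)).
have -> : C * h^-1 ^+ n * ((n.+2)`!%:R * h ^+ n.+2) =
    C * ((n.+2)`!%:R * h ^+ 2).
  rewrite -addn2 [h ^+ _]exprD exprVn; field.
  by rewrite expf_neq0// gt_eqF.
by rewrite -mulrA ler_wpM2r ?ler_norm// mulr_ge0 ?sqr_ge0.
Qed.

Lemma is_derive_flat P (x : R) : is_derive x 1 (flat P) (flat ('X^2 * (P - P^`())) x).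
Proof.
have [x0|x0|->] := ltrgtP x 0.
- rewrite {2}/flat ltNge (ltW x0)/=.
  apply: (@near_eq_is_derive _ _ _ (cst 0)).
  near=> y; rewrite /flat ltNge ifN// negbK; apply: ltW.
  by near: y; exact: lt_nbhsl.
- have xn : x != 0 by rewrite gt_eqF.
  have dV : is_derive x 1 (fun y : R => y^-1) (- x ^- 2).
    have := @is_deriveV R id x 1 1 xn (is_derive_id _ _).
    by rewrite /GRing.scale/= mulr1.
  have d1 : is_derive x 1 (fun y => P.[y^-1]) (- x ^- 2 * P^`().[x^-1]).
    rewrite mulrC.
    exact: (@is_derive1_comp R (horner P) _ x _ _ (is_derive_poly P _) dV).
  have d2 : is_derive x 1 (fun y => expR (- y^-1)) (x ^- 2 * expR (- x^-1)).
    rewrite mulrC -[x ^- 2]opprK.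
    have dN : is_derive x 1 (fun y : R => - y^-1) (- - x ^- 2).
      exact: is_deriveN.
    exact: (@is_derive1_comp R expR _ x _ _ (is_derive_expR _) dN).
  have d : is_derive x 1 (fun y => P.[y^-1] * expR (- y^-1))
      (flat ('X^2 * (P - P^`())) x).
    apply: (is_derive_eq (is_deriveM d1 d2)).
    by rewrite /flat x0 hornerM hornerXn hornerD hornerN exprVn /GRing.scale/=; ring.
  apply: near_eq_is_derive d.
  near=> y; rewrite /flat ifT//.
  by near: y; exact: lt_nbhsr.
- rewrite [flat _ 0]/flat ltxx.
  have [C PC] := flat_quadratic P.
  exact: is_derive0_quadratic PC.
Unshelve. all: by end_near. Qed.

(** The products of a function that is flat at 0 and one that is flat at 1, closed
    under sums so as to contain the two terms of Leibniz' rule. *)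
Inductive bump_class : (R -> R) -> Prop :=
| bump_prod P Q : bump_class (fun x => flat P x * flat Q (1 - x))
| bump_add f g : bump_class f -> bump_class g -> bump_class (fun x => f x + g x).

Lemma bump_class_derive f : bump_class f ->
  (forall x, derivable f x 1) /\ bump_class (derive1 f).
Proof.
elim=> {f} [P Q|f g _ [df bf] _ [dg bg]].
  have dQ (x : R) : is_derive x 1 (fun x => flat Q (1 - x))
      (flat ('X^2 * (Q^`() - Q)) (1 - x)).
    have d1 : is_derive x 1 (fun x : R => 1 - x) (0 - 1).
      exact: is_deriveB.
    apply: (is_derive_eq (is_derive1_comp (is_derive_flat Q _) d1)).
    rewrite sub0r mulrN1 /flat; case: ifP; rewrite ?oppr0// => _.
    by rewrite !hornerM !hornerD !hornerN; ring.
  have d (x : R) : is_derive x 1 (fun x => flat P x * flat Q (1 - x))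
     (flat ('X^2 * (P - P^`())) x * flat Q (1 - x) +
      flat P x * flat ('X^2 * (Q^`() - Q)) (1 - x)).
    apply: (is_derive_eq (is_deriveM (is_derive_flat P x) (dQ x))).
    by rewrite /GRing.scale/= addrC mulrC; congr (_ + _); rewrite mulrC.
  split; first by move=> x; exact: ex_derive.
  rewrite (_ : derive1 _ = fun x => flat ('X^2 * (P - P^`())) x * flat Q (1 - x) +
      flat P x * flat ('X^2 * (Q^`() - Q)) (1 - x)); last first.
    by apply/funext => x; rewrite derive1E derive_val.
  by apply: bump_add; apply: bump_prod.
split; first by move=> x; apply: derivableD; [exact: df|exact: dg].
rewrite (_ : derive1 _ = fun x => derive1 f x + derive1 g x); first exact: bump_add.
by apply/funext => x; rewrite !derive1E deriveD.
Qed.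

Lemma bump_class_smooth f n x : bump_class f -> derivable (derive1n n f) x 1.
Proof.
move=> bf; suff bn : bump_class (derive1n n f) by have [] := bump_class_derive bn.
by elim: n => //= n IH; have [] := bump_class_derive IH.
Qed.

Definition smooth_bump (x : R) : R := flat 1 x * flat 1 (1 - x).

Lemma bump_smooth n x : derivable (derive1n n smooth_bump) x 1.
Proof. by apply: bump_class_smooth; exact: bump_prod. Qed.

Lemma flat1_ge0 (x : R) : 0 <= flat 1 x.
Proof. by rewrite /flat; case: ifP => //; rewrite hornerE mul1r expR_ge0. Qed.

Lemma bump_ge0 x : 0 <= smooth_bump x.
Proof. by rewrite mulr_ge0// flat1_ge0. Qed.

Lemma bump_gt0 x : 0 < x < 1 -> 0 < smooth_bump x.
Proof.
case/andP=> x0 x1; rewrite /smooth_bump /flat x0 subr_gt0 x1 -polyC1 !hornerC !mul1r.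
by rewrite mulr_gt0 ?expR_gt0.
Qed.

Lemma bump_out x : ~~ (0 < x < 1) -> smooth_bump x = 0.
Proof.
rewrite negb_and -!leNgt /smooth_bump /flat => /orP[|] x0.
  by rewrite ltNge x0 mul0r.
by rewrite [0 < 1 - x]ltNge subr_le0 x0 mulr0.
Qed.

End SmoothBump.

(** * Integrals off a null set, and primitives of bounded functions *)

Section NullSets.
Import HBNNSimple.
Context d {X : measurableType d} {R : realType}.
Variable mu : {measure set X -> \bar R}.
Implicit Types (D N : set X) (f g : X -> \bar R).

(** The function f may fail to be measurable.  It is the supremum in the definition of
    the integral that is insensitive to N: restricting a simple function to the
    complement of N does not change its integral. *)
Let ge0_integral_setD_null D N f : measurable N -> mu N = 0%E ->
    (forall x, D x -> (0 <= f x)%E) ->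
  (\int[mu]_(x in D) f x = \int[mu]_(x in D `\` N) f x)%E.
Proof.
move=> mN N0 f0.
have f0' x : (D `\` N) x -> (0 <= f x)%E by case=> /f0.
rewrite !ge0_integralE//; apply/eqP; rewrite eq_le; apply/andP; split.
- apply: ub_ereal_sup => _ [h /= hf <-].
  have projE : (proj_nnsfun h (measurableC mN) : X -> R) = h \_ (~` N).
    by rewrite -mrestrict.
  apply: ereal_sup_ubound; exists (proj_nnsfun h (measurableC mN)).
    move=> x; rewrite projE !patchE in_setD in_setC.
    have := hf x; rewrite patchE.
    by case: (x \in D); case: (x \in N) => //=; apply.
  rewrite -!integralT_nnsfun projE [RHS](ge0_negligible_integral _ _ _ _ N0)//.
    rewrite setTD [RHS]integral_mkcond.
    by apply: eq_integral => x _ /=; rewrite !patchE; case: ifP.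
    exact/measurable_EFinP.
  by move=> x _; rewrite lee_fin fun_ge0.
- apply: ereal_sup_le => _ [h /= hf <-]; exists h => //= x.
  apply: (le_trans (hf x)); rewrite !patchE in_setD.
  case: (boolP (x \in D)) => //= /set_mem/f0 fx; case: ifP => //.
Qed.

Lemma integral_setD_null D N f : measurable N -> mu N = 0%E ->
  (\int[mu]_(x in D) f x = \int[mu]_(x in D `\` N) f x)%E.
Proof.
move=> mN N0; rewrite integralE [RHS]integralE.
by congr (_ - _)%E; apply: ge0_integral_setD_null.
Qed.

Lemma eq_integral_off_null D N f g : measurable N -> mu N = 0%E ->
    (forall x, D x -> ~ N x -> f x = g x) ->
  (\int[mu]_(x in D) f x = \int[mu]_(x in D) g x)%E.
Proof.
move=> mN N0 fg; rewrite (integral_setD_null D f mN N0) (integral_setD_null D g mN N0).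
by apply: eq_integral => x /set_mem[Dx Nx]; exact: fg.
Qed.

(** A chosen weak derivative may leave [-a, a] on a null set, where Phi is
    arbitrary, so the integrand of the functionals may fail to be measurable there. *)
Lemma ae_eq_integral_nonmeasurable D f g :
  {ae mu, forall x, D x -> f x = g x} ->
  (\int[mu]_(x in D) f x = \int[mu]_(x in D) g x)%E.
Proof.
move=> [N [mN N0 fgN]]; apply: (eq_integral_off_null mN N0) => x Dx Nx.
by apply: contrapT => fg; apply/Nx/fgN => /= /(_ Dx).
Qed.

End NullSets.

Section Indefinite.
Context {R : realType}.
Notation mu := (@lebesgue_measure R).
Implicit Types (D : set R) (f g : R -> R) (M c s t T : R).

Lemma itv_finite_measure (b1 b2 : bool) s t :
  (mu [set` Interval (BSide b1 s) (BSide b2 t)] < +oo)%E.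
Proof. by rewrite lebesgue_measure_itv/=; case: ifP; rewrite ?ltry. Qed.

Lemma bounded_integrable D f M : measurable D -> (mu D < +oo)%E ->
    measurable_fun D f -> (forall x, D x -> `|f x| <= M) ->
  mu.-integrable D (EFin \o f).
Proof.
move=> mD D_fin mf fM; apply: measurable_bounded_integrable => //.
exists M; split; first exact: num_real.
by move=> M' MM' x Dx; apply: (le_trans (fM _ Dx)); exact: ltW.
Qed.

Lemma Rintegral_le_bound D f M : measurable D -> (mu D < +oo)%E ->
    measurable_fun D f -> (forall x, D x -> `|f x| <= M) ->
  `| \int[mu]_(x in D) f x | <= M * fine (mu D).
Proof.
move=> mD D_fin mf fM.
have fi := bounded_integrable mD D_fin mf fM.
apply: (le_trans (le_normr_Rintegral _ fi)) => //.
rewrite -Rintegral_cst//; apply: le_Rintegral => //.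
  exact: integrable_norm.
exact: (@bounded_integrable D (cst M) `|M|).
Qed.

Definition bounded_mfun M g := measurable_fun setT g /\ forall x, `|g x| <= M.

Lemma bounded_mfun_integrable D M g : measurable D -> (mu D < +oo)%E ->
  bounded_mfun M g -> mu.-integrable D (EFin \o g).
Proof.
move=> mD Dfin [mg gM]; apply: (bounded_integrable (M := M)) => //.
exact: measurable_funTS.
Qed.

Lemma bounded_mfunD M1 M2 g1 g2 : bounded_mfun M1 g1 -> bounded_mfun M2 g2 ->
  bounded_mfun (M1 + M2) (fun x => g1 x + g2 x).
Proof.
move=> [m1 b1] [m2 b2]; split; first exact: measurable_funD.
by move=> x; rewrite (le_trans (ler_normD _ _))// lerD.
Qed.

Lemma bounded_mfunZ M c g : bounded_mfun M g -> bounded_mfun (`|c| * M) (fun x => c * g x).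
Proof.
move=> [m b]; split; first by apply: measurable_funM => //; exact: measurable_cst.
by move=> x; rewrite normrM ler_wpM2l.
Qed.

Lemma bounded_mfunM M1 M2 g1 g2 : bounded_mfun M1 g1 -> bounded_mfun M2 g2 ->
  bounded_mfun (M1 * M2) (fun x => g1 x * g2 x).
Proof.
move=> [m1 b1] [m2 b2]; split; first exact: measurable_funM.
by move=> x; rewrite normrM ler_pM.
Qed.

Lemma bounded_mfun_norm M g : bounded_mfun M g -> bounded_mfun M (fun x => `|g x|).
Proof.
move=> [m b]; split; first exact: measurableT_comp.
by move=> x; rewrite normr_id.
Qed.

Definition indefinite g t := \int[mu]_(x in `[0, t]) g x.

Lemma indefinite0 g : indefinite g 0 = 0.
Proof. by rewrite /indefinite set_itv1 Rintegral_set1. Qed.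

Lemma indefiniteB M g s t : bounded_mfun M g -> 0 <= s -> s <= t ->
  indefinite g t - indefinite g s = \int[mu]_(x in `]s, t]) g x.
Proof.
move=> gM s0 st; rewrite /indefinite; apply: Rintegral_itvB.
- apply: bounded_mfun_integrable gM => //; exact: itv_finite_measure.
- by rewrite bnd_simp.
- by rewrite bnd_simp.
Qed.

Lemma indefinite_lipschitz M g s t : bounded_mfun M g -> 0 <= s -> 0 <= t ->
  `|indefinite g t - indefinite g s| <= M * `|t - s|.
Proof.
move=> gM; wlog st : s t / s <= t.
  move=> W s0 t0; have [st|/ltW ts] := leP s t; first exact: W.
  by rewrite distrC (distrC t); exact: W.
move=> s0 t0; rewrite (indefiniteB gM)//.
have /= := @Rintegral_le_bound `]s, t] g M.
rewrite lebesgue_measure_itv/= lte_fin.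
have -> : fine (if s < t then (t%:E - s%:E)%E else 0%E) = `|t - s|.
  case: ltP => //= [st'|ts]; first by rewrite gtr0_norm ?subr_gt0.
  by have -> : s = t by [apply/eqP; rewrite eq_le st ts]; rewrite subrr normr0.
apply => //; last by move=> x _; case: gM.
  by case: ifP; rewrite ?ltry.
by apply: measurable_funTS; case: gM.
Qed.

Lemma lipschitz_within_continuous (a b L : R) f :
    (forall x y, x \in `[a, b] -> y \in `[a, b] -> `|f x - f y| <= L * `|x - y|) ->
  {within `[a, b], continuous f}.
Proof.
move=> fL; apply/subspace_continuousP => x xab; apply/cvgrPdist_le => e e0.
have L0 : 0 < `|L| + 1 by rewrite ltr_wpDl.
rewrite near_withinE; near=> y => yab.
apply: (le_trans (fL _ _ xab yab)).
apply: (@le_trans _ _ ((`|L| + 1) * `|x - y|)).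
  by rewrite ler_wpM2r// (le_trans (ler_norm L))// lerDl ler01.
rewrite mulrC -ler_pdivlMr//.
near: y; exists (e / (`|L| + 1)); first by rewrite /= divr_gt0.
by move=> z /= /ltW.
Unshelve. all: by end_near. Qed.

Lemma indefinite_continuous M g T : bounded_mfun M g ->
  {within `[0, T], continuous (indefinite g)}.
Proof.
move=> gM; apply: (@lipschitz_within_continuous _ _ M) => x y.
by rewrite !in_itv/= => /andP[x0 _] /andP[y0 _]; exact: indefinite_lipschitz.
Qed.

End Indefinite.

(** * Test functions with a plateau *)

Section SmoothStep.
Context {R : realType}.
Notation mu := (@lebesgue_measure R).
Implicit Types (b f g u : R -> R) (s t e T : R).

Definition smooth f := forall n x, derivable (derive1n n f) x 1.

Lemma smooth_is_derive f (x : R) : smooth f -> is_derive x 1 f (derive1 f x).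
Proof.
by move=> /(_ 0%N x) df; rewrite derive1E; exact: derivableP.
Qed.

Lemma smooth_continuous f : smooth f -> continuous f.
Proof.
by move=> /(_ 0%N) df x; apply/differentiable_continuous/derivable1_diffP; exact: df.
Qed.

Definition bump_mass : R := \int[mu]_(x in `[-1, 1]) smooth_bump x.

Lemma bump_continuous : continuous (@smooth_bump R).
Proof. exact/smooth_continuous/bump_smooth. Qed.

Lemma bump_integrable s t : mu.-integrable `[s, t] (EFin \o (@smooth_bump R)).
Proof.
apply: continuous_compact_integrable; first exact: segment_compact.
exact/continuous_subspaceT/bump_continuous.
Qed.

Lemma bump_integral_le0 (x : R) : x <= 0 -> \int[mu]_(y in `[-1, x]) smooth_bump y = 0.
Proof.
move=> x0; rewrite (@eq_Rintegral _ _ _ _ _ (cst 0)) ?Rintegral_cst ?mul0r//.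
move=> y /set_mem; rewrite /= in_itv/= => /andP[_ yx]; apply: bump_out.
by rewrite ltNge (le_trans yx x0).
Qed.

Lemma bump_integral_ge1 (x : R) : 1 <= x -> \int[mu]_(y in `[-1, x]) smooth_bump y = bump_mass.
Proof.
move=> x1; rewrite /bump_mass Rintegral_mkcond [RHS]Rintegral_mkcond.
apply: eq_Rintegral => y _; rewrite !patchE.
have [y01|/bump_out->] := boolP (0 < y < 1); last by do 2 case: ifP.
case/andP: y01 => y0 y1; rewrite !mem_set//= in_itv/=.
  by rewrite (ltW y1) (le_trans _ (ltW y0))// oppr_le0.
by rewrite (le_trans (ltW y1))// (le_trans _ (ltW y0))// oppr_le0.
Qed.

Lemma is_derive_bump_integral (x : R) :
  is_derive x 1 (fun x => \int[mu]_(y in `[-1, x]) smooth_bump y) (smooth_bump x).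
Proof.
have [x1|x1] := leP x (-1).
  rewrite bump_out; last by rewrite ltNge (le_trans x1)// oppr_le0.
  apply: (@near_eq_is_derive _ _ _ (cst 0)).
  near=> y; rewrite bump_integral_le0//.
  apply: ltW; near: y; apply: lt_nbhsl.
  by rewrite (le_lt_trans x1)// oppr_lt0.
have xx : x < x + 1 by rewrite ltrDl.
have [df <-] := @continuous_FTC1_closed R smooth_bump (-1) x (x + 1) xx
  (bump_integrable _ _) x1 (@bump_continuous x).
by rewrite derive1E; exact: derivableP.
Unshelve. all: by end_near. Qed.

Lemma bump_mass_gt0 : 0 < bump_mass.
Proof.
have [| |c c01] := @MVT R (fun x => \int[mu]_(y in `[-1, x]) smooth_bump y) smooth_bump 0 1 ltr01.
- by move=> x _; exact: is_derive_bump_integral.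
- apply: derivable_within_continuous => x _.
  by have [] := is_derive_bump_integral x.
- rewrite bump_integral_ge1// bump_integral_le0// !subr0 mulr1 => ->.
  by apply: bump_gt0; move: c01; rewrite in_itv.
Qed.

Definition nbump (x : R) : R := smooth_bump x / bump_mass.

Definition step (x : R) : R := (\int[mu]_(y in `[-1, x]) smooth_bump y) / bump_mass.

Lemma is_derive_step (x : R) : is_derive x 1 step (nbump x).
Proof.
have d1 := is_derive_bump_integral x.
rewrite /step /nbump.
apply: (is_derive_eq (is_deriveM d1 (is_derive_cst bump_mass^-1 x 1))).
by rewrite scaler0 add0r /GRing.scale/= mulrC.
Qed.

Lemma step_le0 (x : R) : x <= 0 -> step x = 0.
Proof. by move=> x0; rewrite /step bump_integral_le0// mul0r. Qed.

Lemma step_ge1 (x : R) : 1 <= x -> step x = 1.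
Proof. by move=> x1; rewrite /step bump_integral_ge1// divff// gt_eqF// bump_mass_gt0. Qed.

Lemma nbump_smooth : smooth nbump.
Proof.
move=> n x; apply: bump_class_smooth.
rewrite (_ : nbump = fun x => flat (bump_mass^-1)%:P x * flat 1 (1 - x)).
  exact: bump_prod.
apply/funext => y; rewrite /nbump /smooth_bump mulrAC; congr (_ * _).
rewrite /flat; case: ifP => _; last by rewrite mul0r.
by rewrite -polyC1 !hornerC mul1r mulrC.
Qed.

Lemma derive1_step : derive1 step = nbump.
Proof.
by apply/funext => x; have := is_derive_step x => d; rewrite derive1E derive_val.
Qed.

Lemma step_smooth : smooth step.
Proof.
case=> [|n] x; first by have [] := is_derive_step x.
by rewrite /derive1n iterSr derive1_step; exact: nbump_smooth.
Qed.

(** The factor k makes the family stable under differentiation, with b replaced by its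
    derivative and k by k / e. *)
Definition rescaled_diff (k e s t : R) b (x : R) : R :=
  k * (b ((x - s) / e) - b ((x - t) / e)).

Lemma is_derive_rescaled_diff (k e s t x : R) b : smooth b ->
  is_derive x 1 (rescaled_diff k e s t b) (rescaled_diff (k / e) e s t (derive1 b) x).
Proof.
move=> sb.
have dl c : is_derive x 1 (fun x : R => (x - c) / e) (e^-1).
  have d0 : is_derive x 1 (fun x : R => x - c) (1 - 0) by exact: is_deriveB.
  apply: (is_derive_eq (is_deriveM d0 (is_derive_cst e^-1 x 1))).
  by rewrite scaler0 add0r /GRing.scale/= subr0 mulr1.
have db c := @is_derive1_comp R b (fun x => (x - c) / e) x _ _
  (smooth_is_derive ((x - c) / e) sb) (dl c).
have d := is_deriveM (is_derive_cst k x 1) (is_deriveB (db s) (db t)).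
apply: (is_derive_eq d).
by rewrite /rescaled_diff scaler0 addr0 /GRing.scale/=; ring.
Qed.

Lemma smooth_derive1 b : smooth b -> smooth (derive1 b).
Proof. by move=> sb n x; have := sb n.+1 x; rewrite /derive1n iterSr. Qed.

Lemma rescaled_diff_smooth (k e s t : R) b : smooth b -> smooth (rescaled_diff k e s t b).
Proof.
move=> sb n; elim: n b k sb => [|n IH] b k sb x.
  by have [] := is_derive_rescaled_diff k e s t x sb.
rewrite /derive1n iterSr.
rewrite (_ : derive1 _ = rescaled_diff (k / e) e s t (derive1 b)).
  exact/IH/smooth_derive1.
apply/funext => y; have := is_derive_rescaled_diff k e s t y sb => d.
by rewrite derive1E derive_val.
Qed.

(** The difference of two translated smooth steps approximates the indicator of
    [s, t]; its derivative is the difference of two approximate Dirac masses, at s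
    and at t. *)
Lemma test_function_plateau T e s t : 0 < e -> 0 < s -> s <= t -> t + e < T ->
  test_function T (rescaled_diff 1 e s t step).
Proof.
move=> e0 s0 st tT; set p := rescaled_diff _ _ _ _ _.
have supp : [set x | p x != 0] `<=` `[s, t + e].
  move=> x /=; apply: contraNT; rewrite in_itv/= negb_and -!ltNge.
  rewrite /p /rescaled_diff => /orP[xs|xt].
    rewrite !step_le0 ?subrr ?mulr0// pmulr_lle0 ?invr_gt0// subr_le0.
      by rewrite (le_trans (ltW xs)).
    exact: ltW.
  rewrite !step_ge1 ?subrr ?mulr0// ler_pdivlMr// mul1r lerBrDl.
    by rewrite (le_trans _ (ltW xt)).
  by rewrite (le_trans _ (ltW xt))// lerD2r.
have csupp : closure [set x | p x != 0] `<=` `[s, t + e].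
  rewrite [X in _ `<=` X](closure_id _).1; last exact: interval_closed.
  exact: closure_subset.
split.
- exact/rescaled_diff_smooth/step_smooth.
- apply: subclosed_compact csupp; last exact: segment_compact.
  exact: closed_closure.
- apply: (subset_trans csupp) => x; rewrite /= !in_itv/= => /andP[sx xt].
  by rewrite (lt_le_trans s0 sx) (le_lt_trans xt tT).
Qed.

End SmoothStep.

(** * Continuous functions with vanishing weak derivative are constant *)

Section ContinuousOnSegment.
Context {R : realType}.
Notation mu := (@lebesgue_measure R).
Implicit Types (b f g u : R -> R) (s t e T : R).

Lemma within_continuous_integrable a c f : {within `[a, c], continuous f} ->
  mu.-integrable `[a, c] (EFin \o f).
Proof. by move=> cf; apply: continuous_compact_integrable => //; exact: segment_compact. Qed.

Lemma within_continuous_integrable_oo a c f : {within `[a, c], continuous f} ->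
  mu.-integrable `]a, c[ (EFin \o f).
Proof.
move=> cf; apply: integrableS (within_continuous_integrable cf) => //.
exact: subset_itv_oo_cc.
Qed.

Lemma within_continuousM (A : set R) f g : {within A, continuous f} ->
  {within A, continuous g} -> {within A, continuous (fun x => f x * g x)}.
Proof.
move=> /subspace_continuousP cf /subspace_continuousP cg.
by apply/subspace_continuousP => x Ax; apply: cvgM; [exact: cf|exact: cg].
Qed.

Lemma within_continuousD (A : set R) f g : {within A, continuous f} ->
  {within A, continuous g} -> {within A, continuous (fun x => f x + g x)}.
Proof.
move=> /subspace_continuousP cf /subspace_continuousP cg.
by apply/subspace_continuousP => x Ax; apply: cvgD; [exact: cf|exact: cg].
Qed.

Lemma within_continuousB (A : set R) f g : {within A, continuous f} ->
  {within A, continuous g} -> {within A, continuous (fun x => f x - g x)}.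
Proof.
move=> /subspace_continuousP cf /subspace_continuousP cg.
by apply/subspace_continuousP => x Ax; apply: cvgB; [exact: cf|exact: cg].
Qed.

Lemma within_continuous_cst (A : set R) (c : R) :
  {within A, continuous (fun=> c : R)}.
Proof. by apply: continuous_subspaceT => x; exact: cst_continuous. Qed.

Lemma within_continuous_bounded a c f : {within `[a, c], continuous f} ->
  exists2 P, 0 <= P & forall x, x \in `[a, c] -> `|f x| <= P.
Proof.
move=> cf; have [ac|ca] := leP a c; last first.
  exists 0 => // x; rewrite in_itv/= => /andP[ax xc].
  by have := le_trans ax xc; rewrite leNgt ca.
have cn : {within `[a, c], continuous (fun x => `|f x|)}.
  move/subspace_continuousP : cf => cf; apply/subspace_continuousP => x xac.
  by apply: cvg_norm; exact: cf.
by have [d _ dmax] := EVT_max ac cn; exists `|f d|.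
Qed.

Lemma Rintegral_ooE a c f : {within `[a, c], continuous f} ->
  \int[mu]_(x in `]a, c[) f x = \int[mu]_(x in `[a, c]) f x.
Proof.
move=> cf; rewrite /Rintegral; congr fine; apply/esym.
apply: (@integral_itv_bndoo R a c (EFin \o f) true false).
exact: measurable_int (within_continuous_integrable_oo cf).
Qed.

End ContinuousOnSegment.

Section DuBoisReymond.
Context {R : realType}.
Notation mu := (@lebesgue_measure R).
Implicit Types (u : R -> R) (d s t e T : R).

Definition mollifier e s (x : R) : R := nbump ((x - s) / e) / e.

Lemma is_derive_step_affine e s (x : R) :
  is_derive x 1 (fun x => step ((x - s) / e)) (mollifier e s x).
Proof.
have d0 : is_derive x 1 (fun x : R => x - s) (1 - 0) by exact: is_deriveB.
have d1 : is_derive x 1 (fun x : R => (x - s) / e) (e^-1).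
  apply: (is_derive_eq (is_deriveM d0 (is_derive_cst e^-1 x 1))).
  by rewrite scaler0 add0r /GRing.scale/= subr0 mulr1.
exact: (@is_derive1_comp R step (fun x => (x - s) / e) x _ _
  (is_derive_step _) d1).
Qed.

Lemma mollifier_continuous e s : continuous (mollifier e s).
Proof.
have cl : continuous (fun x : R => (x - s) / e).
  by move=> x; apply: cvgM; [apply: cvgB; [exact: cvg_id|exact: cvg_cst]|exact: cvg_cst].
move=> x; apply: cvgM; last exact: cvg_cst.
apply: (@continuous_comp _ _ _ (fun x : R => (x - s) / e) nbump); first exact: cl.
exact/smooth_continuous/nbump_smooth.
Qed.

Lemma mollifier_ge0 e s x : 0 < e -> 0 <= mollifier e s x.
Proof.
by move=> e0; rewrite !divr_ge0 ?bump_ge0 ?ltW// bump_mass_gt0.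
Qed.

Lemma mollifier_out e s x : 0 < e -> x \notin `[s, s + e] -> mollifier e s x = 0.
Proof.
move=> e0; rewrite in_itv/= negb_and -!ltNge => sx.
rewrite /mollifier /nbump bump_out ?mul0r//.
apply/negP => /andP[]; rewrite pmulr_lgt0 ?invr_gt0// subr_gt0 => xs.
rewrite ltr_pdivrMr// mul1r ltrBlDl => xe.
by case/orP: sx; rewrite ltNge ?(ltW xs) ?(ltW xe).
Qed.

Lemma mollifier_mass e s T : 0 < e -> 0 < s -> s + e < T ->
  \int[mu]_(x in `]0, T[) mollifier e s x = 1.
Proof.
move=> e0 s0 sT.
have T0 : 0 < T by rewrite (lt_trans _ sT)// addr_gt0.
have cm : {within `[0, T], continuous (mollifier e s)}.
  exact/continuous_subspaceT/mollifier_continuous.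
pose F (x : R) := step ((x - s) / e).
have cF : continuous F.
  move=> x; apply/differentiable_continuous/derivable1_diffP.
  by have [] := is_derive_step_affine e s x.
rewrite Rintegral_ooE// /Rintegral (@continuous_FTC2 _ _ F)//.
- rewrite /F /= step_ge1; last by rewrite ler_pdivlMr// mul1r lerBrDl ltW.
  by rewrite step_le0 ?subr0// sub0r pmulr_lle0 ?invr_gt0// oppr_le0 ltW.
- split=> [x _||].
  + by have [] := is_derive_step_affine e s x.
  + exact/cvg_at_right_filter/cF.
  + exact/cvg_at_left_filter/cF.
- move=> x _; rewrite derive1E.
  by have := is_derive_step_affine e s x => d; rewrite derive_val.
Qed.

Lemma mollifier_average e s T d u : 0 < e -> 0 < s -> s + e < T ->
    {within `[0, T], continuous u} ->
    (forall x, x \in `[s, s + e] -> `|u x - u s| <= d) ->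
  `| \int[mu]_(x in `]0, T[) (u x * mollifier e s x) - u s| <= d.
Proof.
move=> e0 s0 sT cu ud.
have cm : {within `[0, T], continuous (mollifier e s)}.
  exact/continuous_subspaceT/mollifier_continuous.
have i1 := within_continuous_integrable_oo (within_continuousM cu cm).
have i2 := within_continuous_integrable_oo cm.
have i3 := within_continuous_integrable_oo
  (within_continuousM (@within_continuous_cst _ _ (u s)) cm).
have i4 := within_continuous_integrable_oo (within_continuousM (@within_continuous_cst _ _ d) cm).
rewrite -[X in _ - X]mulr1 -(mollifier_mass e0 s0 sT) -RintegralZl//.
rewrite -RintegralB//.
apply: (@le_trans _ _ (\int[mu]_(x in `]0, T[) `|u x * mollifier e s x - u s * mollifier e s x|)).
  apply: le_normr_Rintegral => //.
  exact: (within_continuous_integrable_oo (within_continuousB (within_continuousM cu cm)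
    (within_continuousM (@within_continuous_cst _ _ (u s)) cm))).
rewrite -[leRHS]mulr1 -(mollifier_mass e0 s0 sT) -RintegralZl//.
apply: le_Rintegral => //.
  apply: (@integrable_norm _ _ _ mu _ (fun x => u x * mollifier e s x - u s * mollifier e s x)).
  exact: (within_continuous_integrable_oo (within_continuousB (within_continuousM cu cm)
    (within_continuousM (@within_continuous_cst _ _ (u s)) cm))).
move=> x _; rewrite -mulrBl normrM (ger0_norm (mollifier_ge0 _ _ e0)).
have [xs|xs] := boolP (x \in `[s, s + e]); first by rewrite ler_wpM2r ?mollifier_ge0 ?ud.
by rewrite mollifier_out// !mulr0.
Qed.

Lemma continuous_within_right s T d u : 0 < s -> s < T -> 0 < d ->
    {within `[0, T], continuous u} ->
  exists2 e, 0 < e & forall x, x \in `[s, s + e] -> `|u x - u s| <= d.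
Proof.
move=> s0 sT d0 /subspace_continuousP /(_ s).
have sI : `[0, T]%classic s by rewrite /= in_itv/= (ltW s0) (ltW sT).
move=> /(_ sI) /cvgrPdist_le /(_ _ d0); rewrite near_withinE => -[/= r r0 rP].
exists (Num.min (r / 2) (T - s)).
  by rewrite lt_min divr_gt0//= subr_gt0.
move=> x; rewrite in_itv/= => /andP[sx xs].
have : x - s <= Num.min (r / 2) (T - s) by rewrite lerBlDl.
rewrite le_min => /andP[xr xT].
rewrite distrC; apply: rP => /=.
  rewrite distrC ger0_norm ?subr_ge0// (le_lt_trans xr)//.
  by move: r0; lra.
by rewrite in_itv/= (le_trans (ltW s0))//=; rewrite lerBlDl subrKC in xT.
Qed.

(** Testing against the plateaus of [test_function_plateau] gives in the limit
    u s - u t = 0, since the averages of u near s and t tend to u s and u t. *)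
Lemma du_bois_reymond T u :
    {within `[0, T], continuous u} ->
    (forall p, test_function T p -> \int[mu]_(x in `]0, T[) (u x * derive1 p x) = 0) ->
  forall s t, 0 < s -> s <= t -> t < T -> u s = u t.
Proof.
move=> cu up s t s0 st tT.
have t0 := lt_le_trans s0 st; have sT := le_lt_trans st tT.
apply/eqP; rewrite -subr_eq0 -normr_le0; apply/ler_addgt0Pl => d d0.
rewrite addr0.
have d20 : 0 < d / 2 by rewrite divr_gt0.
have [e1 e10 e1P] := continuous_within_right s0 sT d20 cu.
have [e2 e20 e2P] := continuous_within_right t0 tT d20 cu.
(* the last bound keeps the support [s, t + e] inside ]0, T[ *)
pose e := Num.min (Num.min e1 e2) ((T - t) / 2).
have e0 : 0 < e by rewrite !lt_min e10 e20 divr_gt0// subr_gt0.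
have ee1 : e <= e1 by rewrite !ge_min lexx.
have ee2 : e <= e2 by rewrite !ge_min lexx orbT.
have teT : t + e < T.
  have : e <= (T - t) / 2 by rewrite ge_min lexx orbT.
  by move: tT; lra.
have seT : s + e < T by rewrite (le_lt_trans _ teT)// lerD2r.
have As := @mollifier_average e s T (d / 2) u e0 s0 seT cu.
have At := @mollifier_average e t T (d / 2) u e0 t0 teT cu.
have sub r e' x : e <= e' -> x \in `[r, r + e] -> x \in `[r, r + e'].
  by move=> ee; rewrite !in_itv/= => /andP[-> /le_trans]/=; apply; rewrite lerD2l.
have {}As := As (fun x xs => e1P x (sub _ _ _ ee1 xs)).
have {}At := At (fun x xs => e2P x (sub _ _ _ ee2 xs)).
have := up _ (test_function_plateau e0 s0 st teT).
have -> : derive1 (rescaled_diff 1 e s t step) =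
    (fun x => mollifier e s x - mollifier e t x).
  apply/funext => x; have := is_derive_rescaled_diff 1 e s t x step_smooth => dd.
  rewrite derive1E derive_val derive1_step /rescaled_diff /mollifier; ring.
have cm r : {within `[0, T], continuous (mollifier e r)}.
  exact/continuous_subspaceT/mollifier_continuous.
under eq_Rintegral do rewrite mulrBr.
rewrite RintegralB//; [|exact/within_continuous_integrable_oo/within_continuousM..].
move: As At; set A := \int[mu]_(x in _) _; set B := \int[mu]_(x in _) _.
rewrite !ler_norml => /andP[As1 As2] /andP[At1 At2] AB.
apply/andP; split; lra.
Qed.

End DuBoisReymond.

(** * Integration by parts for primitives of bounded functions *)

Section IntegrationByParts.
Context {R : realType}.
Notation mu := (@lebesgue_measure R).
Implicit Types (g p u : R -> R) (s t T : R).

Lemma test_function_out T p x : test_function T p -> x \notin `]0, T[ -> p x = 0.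
Proof.
case=> _ _ sp; apply: contraNeq => px; apply: sp.
exact: subset_closure.
Qed.

Lemma test_function_derive_continuous T p : test_function T p -> continuous (derive1 p).
Proof. by case=> sp _ _; exact/smooth_continuous/smooth_derive1. Qed.

Lemma test_function_derive_integral T p y : test_function T p -> y \in `]0, T[ ->
  \int[mu]_(x in `[y, T[) derive1 p x = - p y.
Proof.
move=> tp; rewrite in_itv/= => /andP[y0 yT].
have cp' := test_function_derive_continuous tp.
have cp : continuous p by case: tp => sp _ _; exact: smooth_continuous.
have cyT : {within `[y, T], continuous (derive1 p)} by exact: continuous_subspaceT.
have iyT := within_continuous_integrable cyT.
rewrite Rintegral_itv_bndo_bndc; last first.
  by apply: integrableS iyT => //; exact: subset_itv_co_cc.
rewrite /Rintegral (continuous_FTC2 (F := p))//=.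
  by rewrite (test_function_out (x := T) tp) ?sub0r// in_itv/= ltxx andbF.
split=> [x _||].
- by case: tp => sp _ _; exact: (sp 0%N).
- exact/cvg_at_right_filter/cp.
- exact/cvg_at_left_filter/cp.
Qed.

Let GR := measurableTypeR R.

Lemma fubini_bounded_square T C (k : GR * GR -> R)
    (A : set (GR * GR) := `]0, T[ `*` `]0, T[) :
    measurable_fun setT k -> (forall z, A z -> `|k z| <= C) ->
  (\int[mu]_x \int[mu]_y ((EFin \o k) \_ A) (x, y) =
   \int[mu]_y \int[mu]_x ((EFin \o k) \_ A) (x, y))%E.
Proof.
move=> mk kC.
have mA : measurable A by exact: measurableX.
have Afin : ((mu \x mu)%E A < +oo)%E.
  rewrite [ltLHS]product_measure1E//; apply: lte_mul_pinfty => //.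
    by rewrite ge0_fin_numE//; exact: itv_finite_measure.
  exact: itv_finite_measure.
apply: Fubini.
apply: (integrable_mkcond (mu := (mu \x mu)%E) (EFin \o k) mA).1.
apply: (@measurable_bounded_integrable _ _ _ (mu \x mu)%E k A) => //.
  exact: measurable_funTS.
exists C; split; first exact: num_real.
by move=> r /ltW Cr z Az; apply: le_trans Cr; exact: kC.
Qed.

(** A primitive of g need not be differentiable everywhere, so the classical formula
    does not apply; instead g(y) p'(x) is integrated over the triangle y <= x in both
    orders, and the integral of p' from y to T is - p y. *)
Lemma indefinite_by_parts T M g p : bounded_mfun M g -> test_function T p ->
  \int[mu]_(x in `]0, T[) (indefinite g x * derive1 p x) =
  - \int[mu]_(y in `]0, T[) (g y * p y).
Proof.
move=> gM tp; have [mg gb] := gM.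
have cp' := test_function_derive_continuous tp.
have cp : continuous p by case: tp => sp _ _; exact: smooth_continuous.
have mp' : measurable_fun setT (derive1 p) by exact: continuous_measurable_fun.
have mp : measurable_fun setT p by exact: continuous_measurable_fun.
have [P P0 pP'] := @within_continuous_bounded R 0 T _ (continuous_subspaceT cp').
have pP x : x \in `]0, T[ -> `|derive1 p x| <= P.
  by move=> xT; apply: pP'; exact: subset_itv_oo_cc xT.
pose A : set (GR * GR) := `]0, T[ `*` `]0, T[.
pose k0 (z : GR * GR) : R := if z.2 <= z.1 then g z.2 * derive1 p z.1 else 0.
have mk0 : measurable_fun setT k0.
  apply: measurable_fun_ifT => //.
    by apply: measurable_fun_ler; [exact: measurable_snd|exact: measurable_fst].
  apply: measurable_funM.
    by apply: (measurableT_comp mg); exact: measurable_snd.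
  by apply: (measurableT_comp mp'); exact: measurable_fst.
have k0_le z : A z -> `|k0 z| <= M * P.
  move=> [/= z1 z2]; rewrite /k0; case: ifP => _; last first.
    by rewrite normr0 mulr_ge0// (le_trans _ (gb 0)).
  by rewrite normrM ler_pM// pP.
pose K : GR * GR -> \bar R := (EFin \o k0) \_ A.
have inner1 (x : R) : (\int[mu]_y K (x, y))%E =
    (((fun x => indefinite g x * derive1 p x) \_ `]0, T[) x)%:E.
  rewrite patchE; case: ifPn => [/set_mem xT|xT]; last first.
    apply: integral0_eq => y _; rewrite /K patchE ifN; first by [].
    by apply: contra xT => /set_mem[/= xT _]; exact: mem_set.
  have ix : mu.-integrable `[0, x] (EFin \o g).
    by apply: bounded_mfun_integrable gM => //; exact: itv_finite_measure.
  transitivity (\int[mu]_(y in `[0%R, x]) (derive1 p x * g y)%:E)%E.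
    rewrite [RHS]integral_mkcond.
    (* the square is open, so the two integrands differ at y = 0 *)
    apply: (@eq_integral_off_null _ _ _ mu setT [set 0]) => //.
      exact: lebesgue_measure_set1.
    move=> y _ /= y0; rewrite /K !patchE.
    have [yx|yx] := boolP (y \in (`[0, x]%classic : set R)).
      rewrite mem_set /=; last first.
        split=> //=; move: yx xT; rewrite inE/= !in_itv/= => /andP[y0' yx] /andP[_ xT].
        by rewrite lt_neqAle y0' eq_sym (introN eqP y0)//= (le_lt_trans yx).
      rewrite /k0 /= ifT 1?mulrC//.
      by move: yx; rewrite inE/= in_itv/= => /andP[].
    case: ifPn => // /set_mem[_ /= yT]; rewrite /k0/=; case: ifP => // yx'.
    move: yx; rewrite notin_setE/= in_itv/= yx' andbT; case.
    by move: yT; rewrite in_itv/= => /andP[/ltW].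
  under eq_integral do rewrite EFinM.
  rewrite integralZl// mulrC EFinM; congr (_ * _)%E.
  by rewrite /indefinite /Rintegral fineK// integrable_fin_num.
have inner2 (y : R) : (\int[mu]_x K (x, y))%E =
    (((fun y => - (g y * p y)) \_ `]0, T[) y)%:E.
  rewrite patchE; case: ifPn => [/set_mem yT|yT]; last first.
    apply: integral0_eq => x _; rewrite /K patchE ifN; first by [].
    by apply: contra yT => /set_mem[/= _ yT]; exact: mem_set.
  have iy : mu.-integrable `[y, T[ (EFin \o derive1 p).
    have cyT : {within `[y, T], continuous (derive1 p)} by exact: continuous_subspaceT.
    apply: integrableS (within_continuous_integrable cyT) => //.
    exact: subset_itv_co_cc.
  transitivity (\int[mu]_(x in `[y, T[) (g y * derive1 p x)%:E)%E.
    rewrite [RHS]integral_mkcond; apply: eq_integral => x _; rewrite /K !patchE.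
    have [xy|xy] := boolP (x \in (`[y, T[%classic : set R)).
      rewrite mem_set /=; last first.
        split=> //=; move: xy yT; rewrite inE/= !in_itv/= => /andP[yx xT] /andP[y0 _].
        by rewrite xT (lt_le_trans y0).
      by rewrite /k0 /= ifT//; move: xy; rewrite inE/= in_itv/= => /andP[].
    case: ifPn => // /set_mem[/= xT _]; rewrite /k0/=; case: ifP => // yx'.
    move: xy; rewrite notin_setE/= in_itv/= yx'; case.
    by move: xT; rewrite in_itv/= => /andP[].
  under eq_integral do rewrite EFinM.
  rewrite integralZl// -mulrN EFinM; congr (_ * _)%E.
  rewrite -(test_function_derive_integral tp yT).
  by rewrite /Rintegral fineK// integrable_fin_num.
have E1 : (\int[mu]_x \int[mu]_y K (x, y) =
    \int[mu]_x (((fun x => indefinite g x * derive1 p x) \_ `]0%R, T[) x)%R%:E)%E.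
  by apply: eq_integral => x _; exact: inner1.
have E2 : (\int[mu]_y \int[mu]_x K (x, y) =
    \int[mu]_y (((fun y => - (g y * p y)) \_ `]0%R, T[) y)%R%:E)%E.
  by apply: eq_integral => y _; exact: inner2.
have E : \int[mu]_(x in `]0, T[) (indefinite g x * derive1 p x) =
    \int[mu]_(y in `]0, T[) (- (g y * p y)).
  rewrite Rintegral_mkcond [RHS]Rintegral_mkcond /Rintegral; congr fine.
  by rewrite -E1 -E2; exact: fubini_bounded_square mk0 k0_le.
rewrite E -mulN1r -RintegralZl//.
  by apply: eq_Rintegral => x _; rewrite mulN1r.
have [P' P'0 pP''] := @within_continuous_bounded R 0 T _ (continuous_subspaceT cp).
apply: (@bounded_integrable _ _ _ (M * P')) => //.
- exact: itv_finite_measure.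
- by apply: measurable_funTS; exact: measurable_funM.
- move=> x xT; rewrite normrM ler_pM// pP''//.
  exact: subset_itv_oo_cc xT.
Qed.

End IntegrationByParts.

(** * Weak derivatives and primitives *)

Section WeakDerivative.
Context {R : realType}.
Notation mu := (@lebesgue_measure R).
Implicit Types (g p u v : R -> R) (s t T M c : R).

#[global] Instance ae_lebesgue_filter : Filter (almost_everywhere mu) :=
  ae_filter_ringOfSetsType mu.

Lemma linf_normP T u c : 0 <= c ->
  (linf_norm T u <= c%:E)%E <-> {ae mu, forall x, `]0, T[%classic x -> `|u x| <= c}.
Proof.
move=> c0; rewrite /linf_norm unlock.
have -> : (0 < mu [set: R])%E.
  by rewrite -set_itvNyy lebesgue_measure_itv/= ltry.
split=> [/ess_supP|] H.
  apply: filterS H => x /= + xT.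
  by rewrite lee_fin patchE mem_set.
apply/ess_supP; apply: filterS H => x /= H.
by rewrite lee_fin patchE; case: ifPn => [/set_mem/H//|_]; rewrite normr0.
Qed.

Lemma linf_norm_ge0 T u : (0 <= linf_norm T u)%E.
Proof. exact: Lnorm_ge0. Qed.

Lemma bounded_in_linf T u c : measurable_fun `]0, T[ u ->
  (forall x, x \in `]0, T[ -> `|u x| <= c) -> in_linf T u.
Proof.
move=> mu_ uc; split => //.
have : (linf_norm T u <= `|c|%:E)%E.
  by apply/linf_normP => //; apply: aeW => x /uc /le_trans; apply; exact: ler_norm.
by move/le_lt_trans; apply; rewrite ltry.
Qed.

(** A bound in the essential supremum becomes a pointwise bound after truncation,
    which changes u on a null set only. *)
Lemma linf_truncation T u c : 0 <= c -> measurable_fun `]0, T[ u ->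
    (linf_norm T u <= c%:E)%E ->
  exists2 g, bounded_mfun c g & {ae mu, forall x, `]0, T[%classic x -> u x = g x}.
Proof.
move=> c0 mu_ /(linf_normP _ _ c0) uc.
exists (fun x => Num.max (- c) (Num.min c ((u \_ `]0, T[) x))).
  split.
    apply: measurable_maxr; first exact: measurable_cst.
    apply: measurable_minr; first exact: measurable_cst.
    by apply: (measurable_restrictT u _).1.
  move=> x; rewrite ler_norml le_max lexx/= ge_max ge_min lexx/= andbT.
  by rewrite (le_trans _ c0)// oppr_le0.
apply: filterS uc => x /= uc xT; rewrite patchE mem_set//.
have := uc xT; rewrite ler_norml => /andP[u1 u2].
by rewrite min_r// max_r.
Qed.

Lemma ae_endpoints T (P : R -> Prop) :
    {ae mu, forall x, `]0, T[%classic x -> P x} ->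
  {ae mu, forall x, `[0, T]%classic x -> P x}.
Proof.
have e c : {ae mu, forall x, x != c}.
  exists [set c]; split; [exact: measurable_set1|exact: lebesgue_measure_set1|].
  by move=> x /= /negP; rewrite negbK => /eqP.
move=> H; apply: filterS3 (e 0) (e T) H => x x0 xT; rewrite /= !in_itv/= => H.
by move=> /andP[x0' xT']; apply: H; rewrite !lt_neqAle x0' xT' eq_sym x0 xT.
Qed.

Lemma within_continuous_constant T u c : 0 < T ->
    {within `[0, T], continuous u} -> (forall x, x \in `]0, T[ -> u x = c) ->
  forall x, x \in `[0, T] -> u x = c.
Proof.
move=> T0 /(continuous_within_itvP _ T0) [_ u0 uT] uc.
have E0 : u 0 = c.
  suff cc : u x @[x --> 0^'+] --> c by exact: (cvg_unique (@Rhausdorff R) u0 cc).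
  apply: cvg_near_cst; near=> x; apply: uc; rewrite in_itv/=; apply/andP; split.
    by near: x; exact: nbhs_right_gt.
  by near: x; exact: nbhs_right_lt.
have ET : u T = c.
  suff cc : u x @[x --> T^'-] --> c by exact: (cvg_unique (@Rhausdorff R) uT cc).
  apply: cvg_near_cst; near=> x; apply: uc; rewrite in_itv/=; apply/andP; split.
    by near: x; exact: nbhs_left_gt.
  by near: x; exact: nbhs_left_lt.
move=> x; rewrite in_itv/= => /andP[x0 xT].
have [->//|x0'] := eqVneq x 0; have [->//|xT'] := eqVneq x T.
by apply: uc; rewrite in_itv/= !lt_neqAle x0 xT eq_sym x0' xT'.
Unshelve. all: by end_near. Qed.

Lemma ae_eq_Rintegral (D : set R) u v :
  {ae mu, forall x, D x -> u x = v x} ->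
  \int[mu]_(x in D) u x = \int[mu]_(x in D) v x.
Proof.
move=> uv; rewrite /Rintegral; congr fine; apply: ae_eq_integral_nonmeasurable.
by apply: filterS uv => x /= uv Dx; rewrite uv.
Qed.

(** By [indefinite_by_parts] the difference of u and the primitive of g has weak
    derivative zero, so [du_bois_reymond] applies to it. *)
Lemma weak_derivative_indefinite T u g0 g M : 0 < T ->
    {within `[0, T], continuous u} -> is_weak_derivative T u g0 ->
    bounded_mfun M g -> {ae mu, forall x, `]0, T[%classic x -> g0 x = g x} ->
  forall t, t \in `[0, T] -> u t = u 0 + indefinite g t.
Proof.
move=> T0 cu ug0 gM g0g.
have cg := @indefinite_continuous R M g T gM.
pose U x := u x - indefinite g x.
have cU : {within `[0, T], continuous U} by exact: within_continuousB.
have U0 p : test_function T p -> \int[mu]_(x in `]0, T[) (U x * derive1 p x) = 0.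
  move=> tp; have cp' := test_function_derive_continuous tp.
  under eq_Rintegral do rewrite mulrBl.
  rewrite RintegralB//; try by
    apply/within_continuous_integrable_oo/within_continuousM => //;
    exact: continuous_subspaceT.
  rewrite (indefinite_by_parts gM tp) (ug0 _ tp) opprK addrC.
  rewrite (@ae_eq_Rintegral _ (fun x => g0 x * p x) (fun x => g x * p x)) ?subrr//.
  by apply: filterS g0g => x /= H /H ->.
have Uc := du_bois_reymond cU U0.
have Uh x : x \in `]0, T[ -> U x = U (T / 2).
  rewrite in_itv/= => /andP[x0 xT].
  have [xh|/ltW hx] := leP x (T / 2).
    by apply: Uc => //; move: T0; lra.
  by apply/esym/Uc => //; move: T0; lra.
have UE := within_continuous_constant T0 cU Uh.
move=> t tT; have := UE t tT; have := UE 0; rewrite in_itv/= lexx (ltW T0) => /(_ isT).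
by rewrite /U indefinite0 subr0 => ->; move=> <-; rewrite subrK.
Qed.

(** The primitive of the difference of g1 and g2 vanishes, and by Lebesgue's theorem
    it is differentiable almost everywhere with that difference as derivative. *)
Lemma indefinite_inj T g1 g2 M : bounded_mfun M g1 -> bounded_mfun M g2 ->
    (forall t, t \in `[0, T] -> indefinite g1 t = indefinite g2 t) ->
  {ae mu, forall x, `]0, T[%classic x -> g1 x = g2 x}.
Proof.
move=> g1M g2M g12.
have [mg1 g1b] := g1M; have [mg2 g2b] := g2M.
pose d := (fun x => g1 x - g2 x) \_ `]0, T[.
have md : measurable_fun setT d.
  by apply: (measurable_restrictT _ _).1 => //; apply: measurable_funTS; exact: measurable_funB.
have id : mu.-integrable setT (EFin \o d).
  rewrite /d -restrict_EFin; apply: (integrable_mkcond _ _).1 => //.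
  apply: (@bounded_integrable _ _ _ (M + M)) => //.
  - exact: itv_finite_measure.
  - by apply: measurable_funTS; exact: measurable_funB.
  - by move=> x _; rewrite (le_trans (ler_normB _ _))// lerD.
have iy (y : R) : mu.-integrable `]0, y] (EFin \o d).
  by apply: integrableS id => //; exact: subsetT.
have := @FTC1 R d (BRight 0) iy (open_integrable_locally openT id).
apply: filterS => x /= dx; rewrite in_itv/= => /andP[x0 xT].
have [_ dE] := dx x0.
have {dE} : d x = 0.
  rewrite -dE derive1E.
  pose F (y : R) := \int[mu]_(t in `]0, y]) d t.
  have : is_derive x 1 F 0.
    apply: (@near_eq_is_derive _ _ _ (cst 0)).
    near=> y.
    have y0 : 0 < y by near: y; exact: lt_nbhsr.
    have yT : y < T by near: y; exact: lt_nbhsl.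
    have -> : F y = \int[mu]_(z in `]0, y]) (g1 z - g2 z).
      apply: eq_Rintegral => z /set_mem; rewrite /= in_itv/= => /andP[z0 zy].
      by rewrite /d patchE mem_set//= in_itv/= z0 (le_lt_trans zy).
    have ig g : bounded_mfun M g -> mu.-integrable `]0, y] (EFin \o g).
      by apply: bounded_mfun_integrable => //; exact: itv_finite_measure.
    rewrite RintegralB//; try exact: ig.
    rewrite -(indefiniteB g1M)// ?(ltW y0)// -(indefiniteB g2M)// ?(ltW y0)//.
    by rewrite !indefinite0 g12 ?subrr// in_itv/= (ltW y0) (ltW yT).
  by move=> ?; rewrite derive_val.
rewrite /d patchE mem_set; last by rewrite /= in_itv/= x0.
by move/eqP; rewrite subr_eq0 => /eqP.
Unshelve. all: by end_near. Qed.

End WeakDerivative.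

(** * The constraint set in terms of primitives *)

Section ConstraintSet.
Context {R : realType}.
Notation mu := (@lebesgue_measure R).
Implicit Types (g p u v : R -> R) (t T a c : R).

(** The elements of K seen through a derivative g that is bounded and measurable
    everywhere; the last field ties g to the weak derivative that enters the
    functionals. *)
Record integral_rep T a v g : Prop := IntegralRep {
  rep_bounded : bounded_mfun a g ;
  rep_indefinite : forall t, t \in `[0, T] -> v t = v 0 + indefinite g t ;
  rep_periodic : indefinite g T = 0 ;
  rep_ae : {ae mu, forall x, `[0, T]%classic x -> weak_derivative T v x = g x} }.

Lemma weak_derivativeP T u : W1inf_per T u ->
  in_linf T (weak_derivative T u) /\ is_weak_derivative T u (weak_derivative T u).
Proof. by case=> _ _ exg _; exact: (xgetPex (cst 0) exg). Qed.

Lemma setK_integral_rep T a v : 0 < T -> 0 <= a -> setK T a v ->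
  exists g, integral_rep T a v g.
Proof.
move=> T0 a0 [Wv va].
have [[mwd _] wdv] := weak_derivativeP Wv.
have [g ga wg] := linf_truncation a0 mwd va.
case: Wv => cv _ _ vT.
have vg := weak_derivative_indefinite T0 cv wdv ga wg.
exists g; split => //; last exact: ae_endpoints.
have := vg T; rewrite in_itv/= lexx (ltW T0) => /(_ isT).
by rewrite -vT; lra.
Qed.

Lemma test_function_derive_mean T p : 0 < T -> test_function T p ->
  \int[mu]_(x in `]0, T[) derive1 p x = 0.
Proof.
move=> T0 tp.
have cp' := test_function_derive_continuous tp.
have cp : continuous p by case: tp => sp _ _; exact: smooth_continuous.
rewrite Rintegral_ooE; last exact: continuous_subspaceT.
rewrite /Rintegral (continuous_FTC2 (F := p))//=.
- by rewrite !(test_function_out tp) ?subrr// in_itv/= ltxx ?andbF.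
- exact: continuous_subspaceT.
- split=> [x _||].
  + by case: tp => sp _ _; exact: (sp 0%N).
  + exact/cvg_at_right_filter/cp.
  + exact/cvg_at_left_filter/cp.
Qed.

Lemma indefinite_weak_derivative T M u g : 0 < T -> bounded_mfun M g ->
    (forall t, t \in `[0, T] -> u t = u 0 + indefinite g t) ->
  is_weak_derivative T u g.
Proof.
move=> T0 gM ug p tp.
have cp' := test_function_derive_continuous tp.
transitivity (\int[mu]_(t in `]0, T[) (u 0 * derive1 p t + indefinite g t * derive1 p t)).
  apply: eq_Rintegral => t /set_mem tT; rewrite ug ?mulrDl//.
  exact: subset_itv_oo_cc tT.
have c1 := continuous_subspaceT (A := `[0, T]) cp'.
rewrite RintegralD//; last 2 first.
- exact/within_continuous_integrable_oo/within_continuousM/c1/within_continuous_cst.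
- exact/within_continuous_integrable_oo/within_continuousM/c1/indefinite_continuous/gM.
rewrite RintegralZl//; last exact: within_continuous_integrable_oo.
by rewrite test_function_derive_mean// mulr0 add0r; exact: indefinite_by_parts gM tp.
Qed.

(** That g is one of the weak derivatives of u follows from integration by parts; that
    it agrees with the one selected by [weak_derivative] follows from
    [indefinite_inj], both having primitive u - u 0. *)
Lemma integral_setK T a u g : 0 < T -> 0 <= a -> bounded_mfun a g ->
    (forall t, t \in `[0, T] -> u t = u 0 + indefinite g t) ->
    indefinite g T = 0 ->
  setK T a u /\ integral_rep T a u g.
Proof.
move=> T0 a0 ga ug gT; have [mg gb] := ga.
have cu : {within `[0, T], continuous u}.
  have cc := within_continuousD (@within_continuous_cst _ `[0, T] (u 0))
    (@indefinite_continuous R a g T ga).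
  apply: subspace_eq_continuous cc => t /set_mem tT.
  by rewrite /= /from_subspace -ug.
have mu_ : measurable_fun `]0, T[ u.
  apply: subspace_continuous_measurable_fun => //.
  by apply: continuous_subspaceW cu; exact: subset_itv_oo_cc.
have wu := indefinite_weak_derivative T0 ga ug.
have Wu : W1inf_per T u.
  split => //.
  - have [c _ uc] := within_continuous_bounded cu.
    apply: (@bounded_in_linf _ _ _ c) => // x xT; apply: uc.
    exact: subset_itv_oo_cc xT.
  - exists g; split => //; apply: (@bounded_in_linf _ _ _ a) => //.
    exact: measurable_funTS.
  - by rewrite [RHS]ug ?gT ?addr0// in_itv/= lexx (ltW T0).
have [[mwd wdfin] wdu] := weak_derivativeP Wu.
have wdg : {ae mu, forall x, `]0, T[%classic x -> weak_derivative T u x = g x}.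
  pose c := fine (linf_norm T (weak_derivative T u)).
  have c0 : 0 <= c by rewrite fine_ge0// linf_norm_ge0.
  have cE : (linf_norm T (weak_derivative T u) <= c%:E)%E.
    by rewrite fineK// ge0_fin_numE// linf_norm_ge0.
  have [g' g'c wg'] := linf_truncation c0 mwd cE.
  have ug' := weak_derivative_indefinite T0 cu wdu g'c wg'.
  pose M := Num.max a c.
  have gM : bounded_mfun M g.
    by split=> // x; rewrite le_max gb.
  have g'M : bounded_mfun M g'.
    by case: g'c => mg' g'b; split=> // x; rewrite le_max g'b orbT.
  have gg' t : t \in `[0, T] -> indefinite g' t = indefinite g t.
    by move=> tT; apply: (addrI (u 0)); rewrite -ug// -ug'.
  have := indefinite_inj g'M gM gg'.
  by apply: filterS2 wg' => x /= + + xT => -> // ->.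
split; last by split => //; exact: ae_endpoints.
split => //; apply/linf_normP => //.
by apply: filterS wdg => x /= wx xT; rewrite wx.
Qed.

End ConstraintSet.

(** * Convexity, bounded convergence, almost minimizers *)

Section ConvexityAndMinimizers.
Context {R : realType}.
Notation mu := (@lebesgue_measure R).
Implicit Types (g u : R -> R) (t T a c r : R).

(** Mean value theorem on the two halves of [x, y]. *)
Lemma midpoint_convex a (Phi : R -> R) :
    {within `[- a, a], continuous Phi} ->
    (forall x, x \in `]- a, a[ -> derivable Phi x 1) ->
    {in `]- a, a[ &, {homo derive1 Phi : x y / x < y}} ->
  forall x y, x \in `[- a, a] -> y \in `[- a, a] ->
    Phi ((x + y) / 2) <= (Phi x + Phi y) / 2.
Proof.
move=> cPhi dPhi incr x y; wlog xy : x y / x <= y.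
  move=> W xa ya; have [xy|/ltW yx] := leP x y; first exact: W.
  by rewrite addrC (addrC (Phi x)); exact: W.
rewrite !in_itv/= => /andP[ax xa] /andP[ay ya].
move: xy; rewrite le_eqVlt => /predU1P[->|xy].
  by have -> : (y + y) / 2 = y by [lra]; lra.
pose m := (x + y) / 2.
have xm : x < m by rewrite /m; move: xy; lra.
have my : m < y by rewrite /m; move: xy; lra.
have sub s t : x <= s -> t <= y -> {within `[s, t], continuous Phi}.
  move=> xs ty; apply: continuous_subspaceW cPhi => z; rewrite /= !in_itv/=.
  by move=> /andP[sz zt]; rewrite (le_trans ax) ?(le_trans xs)//= (le_trans zt)// (le_trans ty).
have inn s t z : x <= s -> t <= y -> z \in `]s, t[ -> z \in `]- a, a[.
  rewrite !in_itv/= => xs ty /andP[sz zt].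
  by rewrite (le_lt_trans ax) ?(le_lt_trans xs)//= (lt_le_trans zt)// (le_trans ty).
have mvt s t : x <= s -> s < t -> t <= y ->
    exists2 c, c \in `]s, t[ & Phi t - Phi s = derive1 Phi c * (t - s).
  move=> xs st ty; apply: MVT => //; last exact: sub.
  by move=> z /(inn _ _ _ xs ty) za; rewrite derive1E; apply/derivableP/dPhi.
have [c1 c1I E1] := mvt x m (lexx _) xm (ltW my).
have [c2 c2I E2] := mvt m y (ltW xm) my (lexx _).
have c12 : derive1 Phi c1 < derive1 Phi c2.
  apply: incr; [exact: (inn _ _ _ (lexx x) (ltW my) c1I)|
    exact: (inn _ _ _ (ltW xm) (lexx y) c2I)|].
  by move: c1I c2I; rewrite !in_itv/= => /andP[_ c1m] /andP[mc2 _]; exact: lt_trans mc2.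
have mx : m - x = (y - x) / 2 by rewrite /m; lra.
have ym : y - m = (y - x) / 2 by rewrite /m; lra.
have : derive1 Phi c1 * (m - x) <= derive1 Phi c2 * (y - m).
  by rewrite mx ym ler_wpM2r ?(ltW c12)// divr_ge0// subr_ge0 ltW.
rewrite -E1 -E2 -/m; lra.
Qed.

Lemma bounded_convergence (D : set R) (u_ : (R -> R)^nat) u c :
    measurable D -> (mu D < +oo)%E ->
    (forall n, measurable_fun D (u_ n)) -> measurable_fun D u ->
    (forall n x, D x -> `|u_ n x| <= c) ->
    {ae mu, forall x, D x -> u_ n x @[n --> \oo] --> u x} ->
  \int[mu]_(x in D) u_ n x @[n --> \oo] --> \int[mu]_(x in D) u x.
Proof.
move=> mD Dfin mu_ mfu uc uu.
have ic : lebesgue_measure.-integrable D (EFin \o cst c).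
  by apply: (@bounded_integrable _ _ _ `|c|).
have uE : {ae mu, forall x, D x -> (EFin \o u_ n) x @[n --> \oo] --> (EFin \o u) x}.
  by apply: filterS uu => x H Dx; apply: cvg_EFin; [exact: nearW|exact: H].
have ub : {ae mu, forall x n, D x -> (`|(EFin \o u_ n) x| <= (EFin \o cst c) x)%E}.
  by apply: aeW => x n Dx; rewrite lee_fin uc.
have mE n : measurable_fun D (EFin \o u_ n) by exact/measurable_EFinP.
have mfE : measurable_fun D (EFin \o u) by exact/measurable_EFinP.
have [iu _ cvg] := @dominated_convergence _ _ _ lebesgue_measure D mD
  _ _ _ mE mfE uE ic ub.
apply: fine_cvg.
by rewrite fineK; [exact: cvg|exact: integrable_fin_num].
Qed.

(** S is the limit of the infimum of N over A r as r tends to 0.  Both bounds hold for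
    the same r, which is what the parallelogram identity needs. *)
Lemma nested_almost_minimizers {X : Type} (A : R -> set X) (N : X -> R) (B : R) :
    (forall r r', r <= r' -> A r `<=` A r') -> (forall r, 0 < r -> A r !=set0) ->
    (forall x, 0 <= N x) -> (forall x r, A r x -> N x <= B) ->
  exists S, forall q rho, 0 < q -> 0 < rho -> exists r x,
    [/\ 0 < r <= rho, A r x, N x <= S + q & forall y, A r y -> S - q <= N y].
Proof.
move=> Amono An0 N0 NB.
pose D := [set c | exists2 r, 0 < r & forall y, A r y -> c <= N y].
have D0 : D 0 by exists 1.
have supD : has_sup D.
  split; first by exists 0.
  exists B => c [r r0 cr]; have [x Ax] := An0 r r0.
  by rewrite (le_trans (cr x Ax))// (NB _ r).
exists (sup D) => q rho q0 rho0.
have [c [r0 r00 cr] cS] := sup_adherent q0 supD.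
have r_gt0 : 0 < Num.min r0 rho by rewrite lt_min r00.
have [x [Ax Nx]] : exists x, A (Num.min r0 rho) x /\ N x <= sup D + q.
  apply: contrapT => H.
  have : D (sup D + q).
    exists (Num.min r0 rho) => // y Ay; apply: ltW.
    by rewrite ltNge; apply/negP => Ny; apply: H; exists y.
  move/(sup_upper_bound supD); rewrite gerDl => /(lt_le_trans q0).
  by rewrite ltxx.
exists (Num.min r0 rho), x; split => //.
  by rewrite r_gt0 ge_min lexx orbT.
move=> y Ay; rewrite (le_trans (ltW cS))// cr//.
by apply: (Amono _ _ _ y Ay); rewrite ge_min lexx.
Qed.

End ConvexityAndMinimizers.

(** * Almost everywhere limits *)

Section PointwiseLimits.
Context {R : realType}.
Notation mu := (@lebesgue_measure R).
Implicit Types (g u : R -> R) (t T a c r C : R).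

Lemma bounded_mfun_comp a (Phi : R -> R) : {within `[- a, a], continuous Phi} ->
  exists2 B, 0 <= B & forall g, bounded_mfun a g -> bounded_mfun B (Phi \o g).
Proof.
move=> cPhi; have [B B0 PB] := within_continuous_bounded cPhi.
exists B => // g [mg ga]; have gI x : g x \in `[- a, a] by rewrite in_itv/= -ler_norml.
split; last by move=> x; exact: PB.
have mPhi : measurable_fun setT (Phi \_ `[- a, a]).
  apply: (measurable_restrictT _ _).1 => //.
  exact: subspace_continuous_measurable_fun.
apply: (eq_measurable_fun (Phi \_ `[- a, a] \o g)); last exact: measurableT_comp.
by move=> x _; rewrite /= patchE mem_set//; exact: gI.
Qed.

Lemma within_continuous_cvg a c (Phi : R -> R) (u_ : R^nat) l :
    {within `[a, c], continuous Phi} -> l \in `[a, c] ->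
    (forall n, u_ n \in `[a, c]) -> u_ n @[n --> \oo] --> l ->
  Phi (u_ n) @[n --> \oo] --> Phi l.
Proof.
move=> /subspace_continuousP cPhi lI uI ul.
have := cPhi l lI; apply: cvg_comp => A H.
have {}H : \forall n \near \oo, `[a, c]%classic (u_ n) -> A (u_ n) by exact: ul H.
by apply: (filterS _ H) => n; apply; exact: uI.
Qed.

(** The series of the |u_(n+1) - u_n| has a finite integral, hence is finite almost
    everywhere.  The limit superior, truncated to [-a, a], is a measurable bounded
    function that equals the limit where there is one. *)
Lemma fast_cauchy_ae_cvg T a (u_ : (R -> R)^nat) C :
    (forall n, bounded_mfun a (u_ n)) ->
    (forall n, \int[mu]_(x in `[0, T]) `|u_ n.+1 x - u_ n x| <= C / (2 ^ (n + 1))%:R) ->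
  exists2 u, bounded_mfun a u &
    {ae mu, forall x, `[0, T]%classic x -> u_ n x @[n --> \oo] --> u x}.
Proof.
move=> ua uC.
have mD : measurable (`[0, T]%classic : set R) by [].
have mw n : measurable_fun setT (fun x => `|u_ n.+1 x - u_ n x|).
  apply: measurableT_comp => //; apply: measurable_funB; [by case: (ua n.+1)|by case: (ua n)].
have iw n : mu.-integrable `[0, T] (EFin \o (fun x => `|u_ n.+1 x - u_ n x|)).
  apply: (@bounded_integrable _ _ _ (a + a)) => //.
  - exact: itv_finite_measure.
  - exact: measurable_funTS.
  - move=> x _; rewrite /= normr_id (le_trans (ler_normB _ _))// lerD//.
      by case: (ua n.+1).
    by case: (ua n).
pose w n x := `|u_ n.+1 x - u_ n x|.
pose W x := (\sum_(n <oo) (w n x)%:E)%E.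
have w0 n x : (0 <= (w n x)%:E)%E by rewrite lee_fin normr_ge0.
have mwE n : measurable_fun (`[0, T]%classic : set R) (EFin \o w n).
  by apply/measurable_EFinP; apply: measurable_funTS; exact: mw.
have iW : mu.-integrable `[0, T] W.
  apply/integrableP; split.
    by apply: ge0_emeasurable_sum => [k x _ _|k _]; [exact: w0|exact: mwE].
  have -> : (\int[mu]_(x in `[0%R, T]) `|W x| = \int[mu]_(x in `[0%R, T]) W x)%E.
    by apply: eq_integral => x _; rewrite gee0_abs//; exact: nneseries_ge0.
  have -> : (\int[mu]_(x in `[0%R, T]) W x =
      \sum_(n <oo) \int[mu]_(x in `[0%R, T]) (w n x)%:E)%E.
    by apply: integral_nneseries => // n x _; exact: w0.
  apply: (@le_lt_trans _ _ (\sum_(n <oo) (C / (2 ^ (n + 1))%:R)%:E)%E).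
    apply: lee_nneseries => [i _ _|n _]; first by apply: integral_ge0 => x _; exact: w0.
    rewrite -(fineK (integrable_fin_num _ (iw n)))// lee_fin; exact: uC.
  by rewrite (cvg_lim _ (@cvg_geometric_eseries_half R C 0))// ltry.
pose u x := Num.max (- a) (Num.min a (limn_sup (fun n => u_ n x))).
exists u.
  have ub t : has_ubound (range (u_ ^~ t)).
    by exists a => _ [n _ <-]; rewrite (le_trans (ler_norm _))//; case: (ua n).
  have lb t : has_lbound (range (u_ ^~ t)).
    exists (- a) => _ [n _ <-]; have [_ /(_ t)] := ua n.
    by rewrite ler_norml => /andP[].
  split.
    apply: measurable_maxr; first exact: measurable_cst.
    apply: measurable_minr; first exact: measurable_cst.
    by apply: measurable_fun_limn_sup => [t _|t _|n]; [exact: ub|exact: lb|case: (ua n)].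
  have a0 : 0 <= a by case: (ua 0%N) => _ /(_ 0); apply: le_trans.
  move=> x; rewrite ler_norml le_max lexx/= ge_max ge_min lexx/= andbT.
  by rewrite (le_trans _ a0)// oppr_le0.
have Wae : {ae mu, forall x, `[0, T]%classic x -> W x \is a fin_num}.
  exact: integrable_ae iW.
apply: filterS Wae => x /= Wx xT.
have cw : cvgn (series (w ^~ x)).
  apply: nnseries_is_cvg => [i|]; first exact: normr_ge0.
  by have := Wx xT; rewrite ge0_fin_numE//; exact: nneseries_ge0.
have cu : cvgn (fun n => u_ n x).
  have : cvgn (series (telescope (fun n => u_ n x))) by apply: normed_cvg.
  rewrite telescopeK => ct.
  rewrite (_ : (fun n => u_ n x) = (fun n => u_ n x - u_ 0%N x) \+ (fun=> u_ 0%N x)).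
    by apply: is_cvgD => //; exact: is_cvg_cst.
  by apply/funext => n /=; rewrite subrK.
have lI : limn (fun n => u_ n x) \in `[- a, a].
  rewrite in_itv/=; apply/andP; split.
    apply: limr_ge => //; apply: nearW => n; have [_ /(_ x)] := ua n.
    by rewrite ler_norml => /andP[].
  apply: limr_le => //; apply: nearW => n; have [_ /(_ x)] := ua n.
  by rewrite ler_norml => /andP[].
rewrite /u cvg_limn_supE//.
move: lI; rewrite in_itv/= => /andP[l1 l2].
by rewrite min_r// max_r//; exact: cu.
Qed.

End PointwiseLimits.

(** * Lower semicontinuity of the convex term *)

Section WeakLsc.
Context {R : realType}.
Notation mu := (@lebesgue_measure R).
Implicit Types (g u V : R -> R) (t T a c r : R).

Lemma bounded_mfun_midpoint a g1 g2 : bounded_mfun a g1 -> bounded_mfun a g2 ->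
  bounded_mfun a (fun x => (g1 x + g2 x) / 2).
Proof.
move=> [m1 b1] [m2 b2]; split.
  by apply: measurable_funM; [exact: measurable_funD|exact: measurable_cst].
move=> x; rewrite normrM [X in _ * X]ger0_norm ?invr_ge0// ler_pdivrMr// mulr_natr mulr2n.
by rewrite (le_trans (ler_normD _ _))// lerD.
Qed.

Lemma itv_bounded_integrable t a g : bounded_mfun a g -> mu.-integrable `[0, t] (EFin \o g).
Proof. by apply: bounded_mfun_integrable => //; exact: itv_finite_measure. Qed.

Lemma Rintegral_midpoint t a g1 g2 : bounded_mfun a g1 -> bounded_mfun a g2 ->
  \int[mu]_(x in `[0, t]) ((g1 x + g2 x) / 2) =
  (\int[mu]_(x in `[0, t]) g1 x + \int[mu]_(x in `[0, t]) g2 x) / 2.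
Proof.
move=> g1a g2a.
rewrite -RintegralD//; [|exact: itv_bounded_integrable g1a|exact: itv_bounded_integrable g2a].
by rewrite RintegralZr//; exact: itv_bounded_integrable (bounded_mfunD g1a g2a).
Qed.

Definition sqnorm T g := \int[mu]_(x in `[0, T]) (g x * g x).

Lemma sqnorm_parallelogram T a g1 g2 : bounded_mfun a g1 -> bounded_mfun a g2 ->
  sqnorm T (fun x => g1 x - g2 x) =
  2 * sqnorm T g1 + 2 * sqnorm T g2 - 4 * sqnorm T (fun x => (g1 x + g2 x) / 2).
Proof.
move=> g1a g2a.
have b11 := bounded_mfunM g1a g1a; have b22 := bounded_mfunM g2a g2a.
have bm := bounded_mfun_midpoint g1a g2a; have bmm := bounded_mfunM bm bm.
have i t M g : bounded_mfun M g -> mu.-integrable `[0, t] (EFin \o g).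
  exact: itv_bounded_integrable.
rewrite /sqnorm -RintegralZl//; last exact: i b11.
rewrite -RintegralZl//; last exact: i b22.
rewrite -RintegralZl//; last exact: i bmm.
rewrite -RintegralD//; [|exact: i (bounded_mfunZ 2 b11)|exact: i (bounded_mfunZ 2 b22)].
rewrite -RintegralB//; [|exact: i (bounded_mfunD (bounded_mfunZ 2 b11) (bounded_mfunZ 2 b22))|
  exact: i (bounded_mfunZ 4 bmm)].
by apply: eq_Rintegral => x _; field.
Qed.

(** Young's inequality |x| <= (l + x^2 / l) / 2, integrated. *)
Lemma Rintegral_norm_le T a l g : 0 < T -> 0 < l -> bounded_mfun a g ->
  \int[mu]_(x in `[0, T]) `|g x| <= (l * T + l^-1 * sqnorm T g) / 2.
Proof.
move=> T0 l0 ga.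
have bgg := bounded_mfunM ga ga.
have cl : bounded_mfun `|l| (fun=> l) by split; [exact: measurable_cst|].
have i t M u : bounded_mfun M u -> mu.-integrable `[0, t] (EFin \o u).
  exact: itv_bounded_integrable.
have -> : l * T = \int[mu]_(x in `[0, T]) l.
  by rewrite Rintegral_cst//= lebesgue_measure_itv/= lte_fin T0 /= subr0.
rewrite /sqnorm -RintegralZl//; last exact: i bgg.
rewrite -RintegralD//; [|exact: i cl|exact: i (bounded_mfunZ l^-1 bgg)].
have bb := bounded_mfunD cl (bounded_mfunZ l^-1 bgg).
rewrite -RintegralZr//; last exact: i bb.
apply: le_Rintegral => //.
- exact: i (bounded_mfun_norm ga).
- apply: (i _ _ (fun x => (l + l^-1 * (g x * g x)) * 2^-1)).
  have h : bounded_mfun `|2^-1 : R| (fun=> 2^-1) by split; [exact: measurable_cst|].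
  exact: bounded_mfunM bb h.
- move=> x _.
  rewrite ler_pdivlMr// -(ler_pM2r l0).
  have -> : (l + l^-1 * (g x * g x)) * l = l * l + g x * g x by field; rewrite gt_eqF.
  have -> : g x * g x = `|g x| * `|g x| by rewrite -!expr2 real_normK ?num_real.
  have := sqr_ge0 (`|g x| - l); rewrite expr2; lra.
Qed.

(** The approximate derivatives of V with energy almost e. *)
Definition constrained a (Phi V : R -> R) T e r : set (R -> R) :=
  [set g | [/\ bounded_mfun a g,
    \int[mu]_(x in `[0, T]) Phi (g x) <= e + r &
    forall t, t \in `[0, T] -> `|indefinite g t - V t| <= r]].

Lemma constrained_midpoint a (Phi V : R -> R) T e r g1 g2 :
    {within `[- a, a], continuous Phi} ->
    (forall x y, x \in `[- a, a] -> y \in `[- a, a] ->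
      Phi ((x + y) / 2) <= (Phi x + Phi y) / 2) ->
    constrained a Phi V T e r g1 -> constrained a Phi V T e r g2 ->
  constrained a Phi V T e r (fun x => (g1 x + g2 x) / 2).
Proof.
move=> cPhi conv [g1a P1 V1] [g2a P2 V2].
have bm := bounded_mfun_midpoint g1a g2a.
have [B B0 PB] := bounded_mfun_comp cPhi.
split => //.
  apply: (@le_trans _ _ (\int[mu]_(x in `[0, T]) ((Phi (g1 x) + Phi (g2 x)) / 2))).
    apply: le_Rintegral => //.
    - exact: itv_bounded_integrable (PB _ bm).
    - exact: itv_bounded_integrable (bounded_mfun_midpoint (PB _ g1a) (PB _ g2a)).
    - move=> x _; have [_ b1] := g1a; have [_ b2] := g2a.
      by apply: conv; rewrite in_itv/= -ler_norml.
  rewrite (Rintegral_midpoint T (PB _ g1a) (PB _ g2a)) /=; lra.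
move=> t tT; rewrite /indefinite (Rintegral_midpoint t g1a g2a).
have := V1 t tT; have := V2 t tT; rewrite /indefinite !ler_norml.
by move=> /andP[? ?] /andP[? ?]; apply/andP; split; lra.
Qed.

(** Let G k be an almost minimizer of the L^2 norm in the k-th set.  For consecutive
    indices the midpoint lies in the larger of the two sets, hence its norm is almost
    the minimal one, and the parallelogram identity bounds the distance of G k and
    G (k + 1).  The limit inherits both constraints by bounded convergence. *)
Lemma weak_lower_semicontinuity a (Phi V : R -> R) T e : 0 < T ->
    {within `[- a, a], continuous Phi} ->
    (forall x y, x \in `[- a, a] -> y \in `[- a, a] ->
      Phi ((x + y) / 2) <= (Phi x + Phi y) / 2) ->
    (forall r, 0 < r -> constrained a Phi V T e r !=set0) ->
  exists g, [/\ bounded_mfun a g, \int[mu]_(x in `[0, T]) Phi (g x) <= e &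
    forall t, t \in `[0, T] -> indefinite g t = V t].
Proof.
move=> T0 cPhi conv Cn0.
have [B B0 PB] := bounded_mfun_comp cPhi.
pose A := constrained a Phi V T e.
have Amono r r' : r <= r' -> A r `<=` A r'.
  move=> rr' g [ga gP gV]; split => //.
    by rewrite (le_trans gP)// lerD2l.
  by move=> t tT; rewrite (le_trans (gV _ tT)).
have N0 g : 0 <= sqnorm T g.
  by apply: Rintegral_ge0 => x _; rewrite -expr2 sqr_ge0.
have NB g r : A r g -> sqnorm T g <= a * a * T.
  case=> ga _ _; have bgg := bounded_mfunM ga ga.
  have := @Rintegral_le_bound R `[0, T] (fun x => g x * g x) (a * a).
  rewrite lebesgue_measure_itv/= lte_fin T0 /= subr0 => H.
  apply: (le_trans (ler_norm _)); apply: H => //; first by rewrite ltry.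
    by apply: measurable_funTS; case: bgg.
  by move=> x _; case: bgg.
have [S SP] := nested_almost_minimizers Amono Cn0 N0 NB.
(* 4^-k in squared norm gives 2^-k in L^1 norm, by Young's inequality with l = 2^-k *)
pose q k : R := 2^-1 ^+ k * 2^-1 ^+ k.
have h0 k : 0 < (2^-1 : R) ^+ k by rewrite exprn_gt0.
have q0 k : 0 < q k by rewrite mulr_gt0.
have /choice[F FP] : forall k : nat, exists p : R * (R -> R),
    [/\ 0 < p.1 <= k.+1%:R^-1, A p.1 p.2, sqnorm T p.2 <= S + q k &
      forall y, A p.1 y -> S - q k <= sqnorm T y].
  move=> k; have [|r [g H]] := SP (q k) k.+1%:R^-1 (q0 k).
    by rewrite invr_gt0 ltr0n.
  by exists (r, g).
pose G k := (F k).2; pose r_ k := (F k).1.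
have Ga k : bounded_mfun a (G k) by case: (FP k) => _ [].
have step k : sqnorm T (fun x => G k.+1 x - G k x) <= 8 * q k.
  rewrite (sqnorm_parallelogram T (Ga k.+1) (Ga k)).
  have [_ A1 N1 _] := FP k.+1; have [_ A2 N2 _] := FP k.
  rewrite -/(G k) -/(r_ k) in A2 N2; rewrite -/(G k.+1) -/(r_ k.+1) in A1 N1.
  have qk : q k.+1 <= q k.
    have h1 : (2^-1 : R) <= 1 by lra.
    by rewrite /q !exprS mulrACA ler_piMl ?(ltW (q0 k))// mulr_ile1.
  have mid : S - q k <= sqnorm T (fun x => (G k.+1 x + G k x) / 2).
    have [r12|/ltW r21] := leP (r_ k) (r_ k.+1).
      have [_ _ _ H] := FP k.+1.
      apply: (@le_trans _ _ (S - q k.+1)); first by rewrite lerD2l lerN2.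
      apply: H; apply: constrained_midpoint => //.
      exact: Amono r12 _ A2.
    have [_ _ _ H] := FP k.
    apply: H; apply: constrained_midpoint => //.
    exact: Amono r21 _ A1.
  move: qk mid N1 N2; lra.
(* the squared distance is at most 8 * 4^-k, so the L^1 one is at most (T + 8) / 2^(k+1) *)
have [k|u ua uG] := @fast_cauchy_ae_cvg R T a G (T + 8) Ga.
  have bd : bounded_mfun (a + a) (fun x => G k.+1 x - G k x).
    have [m1 b1] := Ga k.+1; have [m2 b2] := Ga k.
    split; first exact: measurable_funB.
    by move=> x; rewrite (le_trans (ler_normB _ _))// lerD.
  apply: (le_trans (Rintegral_norm_le T0 (h0 k) bd)).
  have l0 := h0 k; have s8 := step k.
  have : (2^-1 ^+ k)^-1 * sqnorm T (fun x => G k.+1 x - G k x) <= 8 * 2^-1 ^+ k.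
    rewrite ler_pdivrMl//; apply: le_trans s8 _; rewrite /q; lra.
  have -> : (2 ^ (k + 1))%:R^-1 = 2^-1 * 2^-1 ^+ k :> R.
    by rewrite addn1 expnS natrM natrX invfM exprVn.
  move: (2^-1 ^+ k) ((2^-1 ^+ k)^-1 * _) => l s; lra.
have inv_cvg : k.+1%:R^-1 @[k --> \oo] --> (0 : R) by exact: cvg_harmonic.
exists u; split => //.
  have PG : \int[mu]_(x in `[0, T]) Phi (G k x) @[k --> \oo] -->
      \int[mu]_(x in `[0, T]) Phi (u x).
    apply: (@bounded_convergence _ _ (fun k => Phi \o G k) (Phi \o u) B) => //.
    - exact: itv_finite_measure.
    - by move=> n; apply: measurable_funTS; case: (PB _ (Ga n)).
    - by apply: measurable_funTS; case: (PB _ ua).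
    - by move=> n x _; case: (PB _ (Ga n)).
    - apply: filterS uG => x /= H xT; apply: within_continuous_cvg (H xT) => //.
        by rewrite in_itv/= -ler_norml; case: ua.
      by move=> n; rewrite in_itv/= -ler_norml; case: (Ga n).
  have ec : (e + k.+1%:R^-1) @[k --> \oo] --> e.
    by rewrite -[X in _ --> X]addr0; apply: cvgD => //; exact: cvg_cst.
  apply: ler_cvg_to PG ec _; apply: nearW => k.
  have [/andP[_ rk] [_ + _] _ _] := FP k.
  by move/le_trans; apply; rewrite lerD2l.
move=> t tT.
have GV : indefinite (G k) t @[k --> \oo] --> indefinite u t.
  apply: (@bounded_convergence _ _ G u a) => //.
  - exact: itv_finite_measure.
  - by move=> n; apply: measurable_funTS; case: (Ga n).
  - by apply: measurable_funTS; case: ua.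
  - by move=> n x _; case: (Ga n).
  - apply: filterS uG => x /= H; rewrite in_itv/= => /andP[x0 xt]; apply: H.
    by move: tT; rewrite !in_itv/= x0 => /andP[_ /(le_trans xt)].
have Gt : indefinite (G k) t @[k --> \oo] --> V t.
  apply/cvgrPdist_le => d d0.
  have := inv_cvg => /cvgrPdist_le /(_ _ d0); apply: filterS => k.
  rewrite sub0r normrN ger0_norm ?invr_ge0// => kd.
  have [/andP[_ rk] [_ _ H] _ _] := FP k.
  by rewrite distrC (le_trans (H _ tT))// (le_trans rk).
exact: (cvg_unique (@Rhausdorff R) GV Gt).
Qed.

End WeakLsc.

(** * Uniform cluster points of equi-Lipschitz sequences *)

Section UniformCluster.
Context {R : realType}.
Implicit Types (s t T M L : R) (v : nat -> R -> R).

Lemma ultrafilter_bounded_limit (U : set_system nat) M (x : nat -> R) :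
    UltraFilter U -> (forall n, `|x n| <= M) ->
  exists p, forall e, 0 < e -> U [set n | `|x n - p| < e].
Proof.
move=> UU xM.
have xU : (x @ U) `[- M, M]%classic.
  have : U [set n | x n \in `[- M, M]].
    by apply: filterS filterT => n _ /=; rewrite in_itv/= -ler_norml xM.
  exact.
have [p [_ pc]] := @segment_compact R (- M) M (x @ U) _ xU.
exists p => e e0.
have [//|Unot] := in_ultra_setVsetC [set n | `|x n - p| < e] UU.
have xUnot : (x @ U) (x @` ~` [set n | `|x n - p| < e]).
  have : U [set n | (x @` ~` [set n | `|x n - p| < e]) (x n)].
    by apply: filterS Unot => n ne; exists n.
  exact.
have [_ [[n /= ne <-]]] := pc _ _ xUnot (nbhsx_ballx p _ e0).
by rewrite /ball/= distrC => /ne.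
Qed.

(** V is the pointwise limit along an ultrafilter on nat.  Uniformity on [0, m d] is
    proved by induction on m: a step of length d costs 2 L d <= 2 e / 3, and e / 3 is
    left for the convergence at m d. *)
Lemma uniform_cluster_lipschitz T M L v :
    0 <= L ->
    (forall n t, t \in `[0, T] -> `|v n t| <= M) ->
    (forall n s t, s \in `[0, T] -> t \in `[0, T] -> `|v n s - v n t| <= L * `|s - t|) ->
  exists V, (forall s t, s \in `[0, T] -> t \in `[0, T] -> `|V s - V t| <= L * `|s - t|) /\
    forall e, 0 < e -> forall N, exists2 n, (N <= n)%N &
      forall t, t \in `[0, T] -> `|v n t - V t| <= e.
Proof.
move=> L0 vM vL.
have [U [UU sU]] := ultraFilterLemma eventually_filter.
have /choice[V VP] : forall t, exists p, t \in `[0, T] ->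
    forall e, 0 < e -> U [set n | `|v n t - p| < e].
  move=> t; have [tT|tT] := boolP (t \in `[0, T]); last by exists 0.
  by have [p pP] := ultrafilter_bounded_limit UU (fun n => vM n t tT); exists p.
have VL s t : s \in `[0, T] -> t \in `[0, T] -> `|V s - V t| <= L * `|s - t|.
  move=> sT tT; apply/ler_addgt0Pr => e e0.
  have e20 : 0 < e / 2 by rewrite divr_gt0.
  have [n [/= ns nt]] := filter_ex (filterI (VP s sT _ e20) (VP t tT _ e20)).
  have vst := vL n s t sT tT.
  have -> : V s - V t = (v n s - v n t) - (v n s - V s) + (v n t - V t) by ring.
  apply: (le_trans (ler_normD _ _)).
  apply: (le_trans (lerD (ler_normB _ _) (lexx _))).
  move: ns nt vst; lra.
exists V; split => // e e0 N.
pose d := e / 3 / (L + 1).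
have d0 : 0 < d by rewrite !divr_gt0// ltr_wpDl.
have Ld : L * d <= e / 3.
  rewrite /d mulrCA ler_piMr//; first by rewrite divr_ge0// ltW.
  by rewrite ler_pdivrMr ?ltr_wpDl// mul1r lerDl.
have grid m : U [set n | forall t, t \in `[0, T] -> t <= m%:R * d -> `|v n t - V t| <= e].
  elim: m => [|m IH].
    have [T0|T0] := leP 0 T; last first.
      apply: filterS filterT => n _ t; rewrite in_itv/= => /andP[t0 tT].
      by have := le_trans t0 tT; rewrite leNgt T0.
    have z : 0 \in `[0, T] by rewrite in_itv/= lexx.
    apply: filterS (VP 0 z _ e0) => n /= /ltW n0 t; rewrite in_itv/= mul0r => /andP[t0 _] t1.
    by have -> : t = 0 by apply/eqP; rewrite eq_le t0 t1.
  have [mT|Tm] := leP (m%:R * d) T; last first.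
    apply: filterS IH => n H t tT _; apply: H => //; apply: ltW.
    by move: tT; rewrite in_itv/= => /andP[_ /le_lt_trans]; apply.
  have mI : m%:R * d \in `[0, T] by rewrite in_itv/= mT mulr_ge0// ltW.
  have e30 : 0 < e / 3 by rewrite divr_gt0.
  apply: filterS2 IH (VP _ mI _ e30) => n /= H1 H2 t tT tm.
  have [tm'|/ltW mt] := leP t (m%:R * d); first exact: H1.
  have dt : `|t - m%:R * d| <= d.
    rewrite ger0_norm ?subr_ge0// lerBlDl.
    by move: tm; rewrite -natr1 mulrDl mul1r.
  have A1 := vL n t (m%:R * d) tT mI.
  have A2 := VL t (m%:R * d) tT mI.
  have A3 : L * `|t - m%:R * d| <= e / 3 by apply: le_trans Ld; rewrite ler_wpM2l.
  have -> : v n t - V t = (v n t - v n (m%:R * d)) - (V t - V (m%:R * d)) +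
      (v n (m%:R * d) - V (m%:R * d)) by ring.
  apply: (le_trans (ler_normD _ _)).
  apply: (le_trans (lerD (ler_normB _ _) (lexx _))).
  move: A1 A2 A3 H2; lra.
pose m := (Num.truncn (T / d)).+1.
have Tm : T <= m%:R * d.
  by rewrite -ler_pdivrMr// ltW// truncnS_gt.
have UN : U [set n | (N <= n)%N] by apply: sU; exists N.
have [n [Nn H]] := filter_ex (filterI UN (grid m)).
exists n => // t tT; apply: H => //.
by move: tT; rewrite in_itv/= => /andP[_ /le_trans]; apply.
Qed.

End UniformCluster.

(** * Regularity of the nonlinear term *)

Section Nonlinearity.
Context {R : realType}.
Notation mu := (@lebesgue_measure R).
Implicit Types (s t T B : R) (f : R -> R -> R) (v : R -> R).

Lemma joint_continuous_slice T f t : t \in `[0, T] ->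
    {within `[0, T] `*` [set: R], continuous (fun z : R * R => f z.1 z.2)} ->
  continuous (f t).
Proof.
move=> tT /subspace_continuousP cf s.
have := cf (t, s) (conj tT I).
pose j (s : R) : R * R := (t, s).
suff cj : j x @[x --> s] --> within (`[0, T] `*` [set: R]) (nbhs (t, s)).
  by move=> H; have := cvg_comp j (fun z : R * R => f z.1 z.2) cj H.
have cj' : j x @[x --> s] --> (t, s).
  by apply: (@cvg_pair _ _ _ _ (nbhs t) (nbhs s)); [exact: cvg_cst|exact: cvg_id].
move=> A HA; have : \forall x \near s, (`[0, T] `*` [set: R]) (j x) -> A (j x) by exact: cj' HA.
by apply: filterS => x; apply; split.
Qed.

(** Composing f with the projection onto [0, T] turns the continuity on [0, T] x R into
    continuity on the whole line, which is what continuity under the integral sign is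
    about. *)
Definition clamp T t : R := Num.max 0 (Num.min T t).

Lemma clamp_itv T t : 0 <= T -> clamp T t \in `[0, T].
Proof.
by move=> T0; rewrite in_itv/= le_max lexx/= ge_max T0 ge_min lexx.
Qed.

Lemma clamp_id T t : t \in `[0, T] -> clamp T t = t.
Proof. by rewrite in_itv/= => /andP[t0 tT]; rewrite /clamp min_r// max_r. Qed.

Lemma clamp_continuous T : continuous (clamp T).
Proof.
move=> t; apply: continuous_max; first exact: cvg_cst.
by apply: continuous_min; [exact: cvg_cst|exact: cvg_id].
Qed.

Lemma joint_continuous_clamp T f s : 0 <= T ->
    {within `[0, T] `*` [set: R], continuous (fun z : R * R => f z.1 z.2)} ->
  continuous (fun t => f (clamp T t) s).
Proof.
move=> T0 /subspace_continuousP cf t.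
have := cf (clamp T t, s) (conj (clamp_itv t T0) I).
pose j (x : R) : R * R := (clamp T x, s).
suff cj : j x @[x --> t] --> within (`[0, T] `*` [set: R]) (nbhs (clamp T t, s)).
  by move=> H; have := cvg_comp j (fun z : R * R => f z.1 z.2) cj H.
have cj' : j x @[x --> t] --> (clamp T t, s).
  by apply: (@cvg_pair _ _ _ _ (nbhs (clamp T t)) (nbhs s));
    [exact: clamp_continuous|exact: cvg_cst].
move=> A HA; have : \forall x \near t, (`[0, T] `*` [set: R]) (j x) -> A (j x) by exact: cj' HA.
by apply: filterS => x; apply; split => //; exact: clamp_itv.
Qed.

(** Compactness for s in a bounded interval, smallness at infinity for the others. *)
Lemma vanishing_bounded T f :
    {within `[0, T] `*` [set: R], continuous (fun z : R * R => f z.1 z.2)} ->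
    lim_infty_unif T f 0 ->
  exists2 B, 0 <= B & forall t s, t \in `[0, T] -> `|f t s| <= B.
Proof.
move=> cf /(_ 1 ltr01)[M fM].
pose A : set (R * R) := `[0, T] `*` `[- `|M|, `|M|].
have cA : compact A by apply: compact_setX; exact: segment_compact.
have cfA : {within A, continuous (fun z : R * R => f z.1 z.2)}.
  by apply: continuous_subspaceW cf => -[x y] /= [? ?].
have /compact_bounded[C [_ CP]] := continuous_compact cfA cA.
exists (`|C| + 1); first by rewrite addr_ge0.
move=> t s tT; have [sM|Ms] := leP `|s| `|M|.
  apply: CP; first by rewrite (le_lt_trans (ler_norm C))// ltrDl.
  by exists (t, s) => //; split => //=; rewrite in_itv/= -ler_norml.
have := fM t s tT (le_lt_trans (ler_norm M) Ms).
by rewrite subr0 => /ltW/le_trans; apply; rewrite lerDr.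
Qed.

Let seg_bound (b : bool) (g : R -> R) B s t : s <= t -> continuous g ->
    (forall x, `|g x| <= B) ->
  `|\int[mu]_(x in [set` Interval (BSide b s) (BRight t)]) g x| <= B * (t - s).
Proof.
move=> st cg gB.
have := @Rintegral_le_bound R [set` Interval (BSide b s) (BRight t)] g B.
rewrite lebesgue_measure_itv/=.
have -> : fine (if (s%:E < t%:E)%E then (t%:E - s%:E)%E else 0%E) = t - s.
  rewrite lte_fin; case: ltP => //= ts.
  by have -> : s = t by [apply/eqP; rewrite eq_le st ts]; rewrite subrr.
apply => //; first by case: ifP; rewrite ?ltry.
by apply: measurable_funTS; exact: continuous_measurable_fun.
Qed.

Lemma primitive0 f t : primitive f t 0 = 0.
Proof. by rewrite /primitive lexx set_itv1 Rintegral_set1. Qed.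

(** The cases s, s' >= 0 and s, s' <= 0 are estimates of one integral; the other case
    goes through 0. *)
Lemma primitive_lipschitz f t B : continuous (f t) -> (forall s, `|f t s| <= B) ->
  forall s s', `|primitive f t s - primitive f t s'| <= B * `|s - s'|.
Proof.
move=> cf fB.
have i (b1 b2 : bool) (x y : R) :
    mu.-integrable [set` Interval (BSide b1 x) (BSide b2 y)] (EFin \o f t).
  apply: (@bounded_integrable _ _ _ B) => //; first exact: itv_finite_measure.
  by apply: measurable_funTS; exact: continuous_measurable_fun.
have same s s' : s <= s' -> 0 <= s \/ s' <= 0 ->
    `|primitive f t s - primitive f t s'| <= B * `|s - s'|.
  move=> ss'; have -> : `|s - s'| = s' - s by rewrite distrC ger0_norm ?subr_ge0.
  case=> [s0|s0].
    rewrite /primitive s0 (le_trans s0 ss') distrC.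
    rewrite (Rintegral_itvB (i true false 0 s')) ?bnd_simp//.
    exact: seg_bound.
  have [->|sn] := eqVneq s' 0.
    rewrite primitive0 subr0 sub0r.
    have [->|sn0] := eqVneq s 0; first by rewrite primitive0 normr0 oppr0 mulr0.
    rewrite /primitive ifN; last by rewrite -ltNge lt_neqAle sn0 (le_trans ss').
    by rewrite normrN -[- s]sub0r; apply: seg_bound => //; exact: le_trans s0.
  have s'0 : s' < 0 by rewrite lt_neqAle sn.
  rewrite /primitive ![0 <= _]leNgt s'0 (le_lt_trans ss' s'0)/=.
  rewrite opprK addrC -(Rintegral_itv_obnd_cbnd (i false false s' 0)).
  rewrite -(Rintegral_itvB (i true false s 0) (x := s')) ?bnd_simp//.
  rewrite addrAC subrr sub0r normrN.
  exact: seg_bound.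
move=> s s'; wlog ss' : s s' / s <= s'.
  move=> W; have [|/ltW] := leP s s'; first exact: W.
  by rewrite distrC (distrC s); exact: W.
have [s0|s0] := leP 0 s; first by apply: same => //; left.
have [s'0|s'0] := leP s' 0; first by apply: same => //; right.
have H1 := same s 0 (ltW s0) (or_intror (lexx 0)).
have H2 := same 0 s' (ltW s'0) (or_introl (lexx 0)).
have -> : primitive f t s - primitive f t s' =
    (primitive f t s - primitive f t 0) + (primitive f t 0 - primitive f t s') by ring.
apply: (le_trans (ler_normD _ _)); apply: (le_trans (lerD H1 H2)).
rewrite -mulrDr subr0 sub0r normrN ltr0_norm// gtr0_norm//.
by rewrite ltr0_norm ?subr_lt0 ?(lt_trans s0)// opprB addrC.
Qed.

Lemma primitive_continuous T f B s : 0 <= T ->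
    {within `[0, T] `*` [set: R], continuous (fun z : R * R => f z.1 z.2)} ->
    (forall t s, t \in `[0, T] -> `|f t s| <= B) ->
  {within `[0, T], continuous (fun t => primitive f t s)}.
Proof.
move=> T0 cf fB.
have cs t := joint_continuous_slice (clamp_itv t T0) cf.
have ci (b1 b2 : bool) (x y : R) : {within `[0, T], continuous
    (fun t => \int[mu]_(z in [set` Interval (BSide b1 x) (BSide b2 y)]) f t z)}.
  pose D := [set` Interval (BSide b1 x) (BSide b2 y)].
  have mD : measurable (D : set R) by exact: measurable_itv.
  have Dfin : (mu D < +oo)%E by exact: itv_finite_measure.
  have H := @continuity_under_integral R _ _ mu (fun t z => f (clamp T t) z) D
    (measurable_itv _) (-1) (T + 1).
  have cc : {in `](-1), T + 1[%classic, continuous (fun t => \int[mu]_(z in D) f (clamp T t) z)}.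
    apply: (H _ _ (cst B)).
    - move=> t _; apply: (@bounded_integrable _ _ _ B) => //.
        by apply: measurable_funTS; exact: continuous_measurable_fun.
      by move=> z _; apply: fB; exact: clamp_itv.
    - by apply: aeW => z _ t _; exact: joint_continuous_clamp.
    - apply: (@bounded_integrable _ _ (cst B) `|B|) => //.
    - by move=> t _; apply: aeW => z _; apply: fB; exact: clamp_itv.
  have cT : {within `[0, T], continuous (fun t => \int[mu]_(z in D) f (clamp T t) z)}.
    apply: continuous_in_subspaceT => t tI.
    have := set_mem tI; rewrite /= in_itv/= => /andP[t0 tT].
    by apply: cc; rewrite inE/= in_itv/=; apply/andP; split; move: t0 tT; lra.
  apply: subspace_eq_continuous cT => t /set_mem tT.
  by rewrite /= /from_subspace clamp_id.
rewrite /primitive; have [s0|s0] := boolP (0 <= s); first exact: ci.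
have := within_continuousB (@within_continuous_cst _ `[0, T] (0 : R)) (ci true false s 0).
by apply: subspace_eq_continuous => t _; rewrite /= /from_subspace sub0r.
Qed.

Lemma primitive_comp_continuous T f B v : 0 <= T -> 0 <= B ->
    {within `[0, T] `*` [set: R], continuous (fun z : R * R => f z.1 z.2)} ->
    (forall t s, t \in `[0, T] -> `|f t s| <= B) ->
    {within `[0, T], continuous v} ->
  {within `[0, T], continuous (fun t => primitive f t (v t))}.
Proof.
move=> T0 B0 cf fB cv; apply/subspace_continuousP => t tT.
have lip t' : t' \in `[0, T] -> forall s s',
    `|primitive f t' s - primitive f t' s'| <= B * `|s - s'|.
  move=> t'T; apply: primitive_lipschitz; first exact: joint_continuous_slice cf.
  by move=> s; exact: fB.
have /subspace_continuousP /(_ t tT) c1 := @primitive_continuous T f B (v t) T0 cf fB.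
move/subspace_continuousP : cv => /(_ t tT) cv.
apply/cvgrPdist_le => e e0.
have e20 : 0 < e / 2 by rewrite divr_gt0.
have B1 : 0 < e / 2 / (B + 1) by rewrite divr_gt0// ltr_wpDl.
move/cvgrPdist_le : c1 => /(_ _ e20) c1.
move/cvgrPdist_le : cv => /(_ _ B1) cv.
rewrite !near_withinE in c1 cv *.
apply: filterS2 c1 cv => x /= c1 cv xT.
have := c1 xT; have := cv xT => {c1 cv} cv c1.
have l1 := lip x xT (v t) (v x).
have l2 : B * `|v t - v x| <= e / 2.
  apply: (@le_trans _ _ (B * (e / 2 / (B + 1)))); first by rewrite ler_wpM2l.
  by rewrite mulrCA ler_piMr ?(ltW e20)// ler_pdivrMr ?ltr_wpDl// mul1r lerDl.
have -> : primitive f t (v t) - primitive f x (v x) =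
  (primitive f t (v t) - primitive f x (v t)) +
  (primitive f x (v t) - primitive f x (v x)) by ring.
apply: (le_trans (ler_normD _ _)).
move: c1 l1 l2; rewrite /from_subspace; lra.
Qed.

End Nonlinearity.

(** * The functionals, and coercivity *)

Section Functionals.
Context {R : realType}.
Notation mu := (@lebesgue_measure R).
Implicit Types (s t T a c B : R) (f : R -> R -> R) (g h q v u Phi : R -> R).

Definition gradient_energy T Phi g := \int[mu]_(t in `[0, T]) Phi (g t).
Definition forcing T h v := \int[mu]_(t in `[0, T]) (h t * v t).
Definition potential T f v := \int[mu]_(t in `[0, T]) primitive f t (v t).

Lemma RintegralD_continuous T q1 q2 :
    {within `[0, T], continuous q1} -> {within `[0, T], continuous q2} ->
  \int[mu]_(t in `[0, T]) (q1 t + q2 t) =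
  \int[mu]_(t in `[0, T]) q1 t + \int[mu]_(t in `[0, T]) q2 t.
Proof. by move=> c1 c2; rewrite RintegralD//; exact: within_continuous_integrable. Qed.

Lemma RintegralZl_continuous T c q : {within `[0, T], continuous q} ->
  \int[mu]_(t in `[0, T]) (c * q t) = c * \int[mu]_(t in `[0, T]) q t.
Proof. by move=> cq; rewrite RintegralZl//; exact: within_continuous_integrable. Qed.

Lemma le_Rintegral_continuous T q1 q2 :
    {within `[0, T], continuous q1} -> {within `[0, T], continuous q2} ->
    (forall t, t \in `[0, T] -> q1 t <= q2 t) ->
  \int[mu]_(t in `[0, T]) q1 t <= \int[mu]_(t in `[0, T]) q2 t.
Proof. by move=> c1 c2 q12; apply: le_Rintegral => //; exact: within_continuous_integrable. Qed.

Lemma Rintegral_itv_cst T c : 0 <= T -> \int[mu]_(t in `[0, T]) c = c * T.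
Proof.
move=> T0; rewrite Rintegral_cst//= lebesgue_measure_itv/= lte_fin.
case: ltP => [_|T0']; first by rewrite /= subr0.
by have -> : T = 0 by apply/eqP; rewrite eq_le T0 T0'.
Qed.

Lemma setK_continuous T a v : setK T a v -> {within `[0, T], continuous v}.
Proof. by case=> -[]. Qed.

Lemma setK_shift T a v g c : 0 < T -> 0 <= a -> integral_rep T a v g ->
  setK T a (fun t => v t + c) /\ integral_rep T a (fun t => v t + c) g.
Proof.
move=> T0 a0 [ga vg gT _]; apply: integral_setK => // t tT.
by rewrite [in LHS]vg// addrAC.
Qed.

Lemma integral_rep_lipschitz T a v g s t : integral_rep T a v g ->
  s \in `[0, T] -> t \in `[0, T] -> `|v s - v t| <= a * `|s - t|.
Proof.
move=> [ga vg _ _] sT tT; rewrite (vg s)// (vg t)// opprD addrACA subrr add0r.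
by apply: indefinite_lipschitz => //; [move: tT|move: sT]; rewrite in_itv/= => /andP[].
Qed.

Lemma functional_value T a Phi v g q :
    {within `[- a, a], continuous Phi} -> integral_rep T a v g ->
    {within `[0, T], continuous q} ->
  (\int[mu]_(t in `[0%R, T]) (Phi (weak_derivative T v t) + q t)%:E)%E =
  (gradient_energy T Phi g + \int[mu]_(t in `[0, T]) q t)%:E.
Proof.
move=> cPhi [ga _ _ wg] cq.
have [B B0 PB] := bounded_mfun_comp cPhi.
have iP := itv_bounded_integrable T (PB _ ga).
have iq := within_continuous_integrable cq.
transitivity (\int[mu]_(t in `[0%R, T]) (Phi (g t) + q t)%:E)%E.
  apply: ae_eq_integral_nonmeasurable.
  by apply: filterS wg => t /= wg tT; rewrite wg.
rewrite /gradient_energy -RintegralD// /Rintegral fineK//.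
exact: integrable_fin_num (integrableD _ iP iq).
Qed.

Lemma functionalJ_value T a Phi h v g :
    {within `[- a, a], continuous Phi} -> {within `[0, T], continuous h} ->
    setK T a v -> integral_rep T a v g ->
  functionalJ T a Phi h v =
  (gradient_energy T Phi g + forcing T h v)%:E.
Proof.
move=> cPhi ch vK vg; rewrite /functionalJ asboolT//.
by apply: functional_value vg _ => //; exact: within_continuousM (setK_continuous vK).
Qed.

Lemma functionalI_value T a Phi h f B v g : 0 <= T -> 0 <= B ->
    {within `[- a, a], continuous Phi} -> {within `[0, T], continuous h} ->
    {within `[0, T] `*` [set: R], continuous (fun z : R * R => f z.1 z.2)} ->
    (forall t s, t \in `[0, T] -> `|f t s| <= B) ->
    setK T a v -> integral_rep T a v g ->
  functionalI T a Phi h f v =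
  (gradient_energy T Phi g + forcing T h v + potential T f v)%:E.
Proof.
move=> T0 B0 cPhi ch cf fB vK vg; rewrite /functionalI asboolT//.
have cv := setK_continuous vK.
have chv := within_continuousM ch cv.
have cF := primitive_comp_continuous T0 B0 cf fB cv.
rewrite -addrA /forcing /potential -RintegralD_continuous// -(functional_value cPhi vg)//.
  by apply: eq_integral => t _; rewrite addrA.
exact: within_continuousD.
Qed.

Lemma Rintegral_dist_le T c q1 q2 : 0 <= T ->
    {within `[0, T], continuous q1} -> {within `[0, T], continuous q2} ->
    (forall t, t \in `[0, T] -> `|q1 t - q2 t| <= c) ->
  `|\int[mu]_(t in `[0, T]) q1 t - \int[mu]_(t in `[0, T]) q2 t| <= c * T.
Proof.
move=> T0 c1 c2 q12.
have cc c' := @within_continuous_cst R `[0, T] c'.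
rewrite ler_norml; apply/andP; split.
- rewrite lerBrDl -mulNr -Rintegral_itv_cst// -RintegralD_continuous//.
  apply: le_Rintegral_continuous => //; first exact: within_continuousD.
  by move=> t /q12; rewrite ler_norml; lra.
- rewrite lerBlDl -Rintegral_itv_cst// -RintegralD_continuous//.
  apply: le_Rintegral_continuous => //; first exact: within_continuousD.
  by move=> t /q12; rewrite ler_norml; lra.
Qed.

Section Coercivity.
Variables (T a B alpha : R) (Phi h : R -> R) (f : R -> R -> R) (w gw : R -> R).
Hypotheses (T_gt0 : 0 < T) (a_gt0 : 0 < a).
Hypothesis Phi_cont : {within `[- a, a], continuous Phi}.
Hypothesis f_cont : {within `[0, T] `*` [set: R], continuous (fun z : R * R => f z.1 z.2)}.
Hypotheses (B0 : 0 <= B) (fB : forall t s, t \in `[0, T] -> `|f t s| <= B).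
Hypothesis h_cont : {within `[0, T], continuous h}.
Hypothesis h_mean0 : \int[mu]_(t in `[0, T]) h t = 0.
Hypotheses (wK : setK T a w) (wg : integral_rep T a w gw).
Hypothesis w_min : is_minimizer (functionalJ T a Phi h) (setW T) w.

Lemma forcing_shift v c : {within `[0, T], continuous v} ->
  forcing T h (fun t => v t + c) = forcing T h v.
Proof.
move=> cv; rewrite /forcing; transitivity (\int[mu]_(t in `[0, T]) (h t * v t + c * h t)).
  by apply: eq_Rintegral => t _; rewrite mulrDr (mulrC c).
rewrite RintegralD_continuous.
- by rewrite RintegralZl_continuous// h_mean0 mulr0 addr0.
- exact: within_continuousM.
- by apply: within_continuousM => //; exact: within_continuous_cst.
Qed.

(** Subtracting its mean from v gives a competitor of w with the same energy, as h has
    mean zero. *)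
Lemma constrained_minimum v g : setK T a v -> integral_rep T a v g ->
  gradient_energy T Phi gw + forcing T h w <= gradient_energy T Phi g + forcing T h v.
Proof.
move=> vK vg; have cv := setK_continuous vK.
pose c := - (T^-1 * \int[mu]_(t in `[0, T]) v t).
have [uK ug] := setK_shift c T_gt0 (ltW a_gt0) vg.
have uW : setW T (fun t => v t + c).
  split; first by case: uK.
  rewrite RintegralD_continuous//; last exact: within_continuous_cst.
  rewrite Rintegral_itv_cst ?ltW// /c mulNr mulrAC mulVf ?mul1r ?subrr//.
  by rewrite gt_eqF.
have := w_min.2 _ uW.
rewrite (functionalJ_value Phi_cont h_cont wK wg) (functionalJ_value Phi_cont h_cont uK ug).
by rewrite lee_fin forcing_shift.
Qed.

(** v is a-Lipschitz, so |v t| > M1 on [0, T] once |v 0| > M1 + a T; there F(t, v t)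
    is within e / T of alpha. *)
Lemma coercivity e : lim_infty_unif T (primitive f) alpha -> 0 < e ->
  exists M, forall v g, setK T a v -> integral_rep T a v g -> M < `|v 0| ->
    gradient_energy T Phi gw + forcing T h w + alpha * T - e <=
    gradient_energy T Phi g + forcing T h v + potential T f v.
Proof.
move=> F_lim e0.
have eT : 0 < e / T by rewrite divr_gt0.
have [M1 M1P] := F_lim _ eT.
exists (M1 + a * T) => v g vK vg vM.
have cv := setK_continuous vK.
have cF := primitive_comp_continuous (ltW T_gt0) B0 f_cont fB cv.
have vt t : t \in `[0, T] -> M1 < `|v t|.
  move=> tT.
  have zT : 0 \in `[0, T] by rewrite in_itv/= lexx ltW.
  have := integral_rep_lipschitz vg zT tT.
  have : a * `|0 - t| <= a * T.
    rewrite ler_wpM2l ?(ltW a_gt0)// sub0r normrN.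
    by have := tT; rewrite in_itv/= => /andP[t0 tT']; rewrite ger0_norm.
  have := lerB_dist (v 0) (v t); move: vM; lra.
rewrite -addrA; apply: lerD; first exact: constrained_minimum.
have -> : alpha * T - e = (alpha - e / T) * T by rewrite mulrBl divfK// gt_eqF.
rewrite -(@Rintegral_itv_cst T (alpha - e / T) (ltW T_gt0)); apply: le_Rintegral_continuous => //.
  exact: within_continuous_cst.
move=> t tT; have := M1P t (v t) tT (vt t tT).
by rewrite ltr_norml => /andP[]; lra.
Qed.

End Coercivity.
End Functionals.

(** * Existence of minimizers *)

Section DirectMethod.
Context {R : realType}.
Notation mu := (@lebesgue_measure R).
Variables (T a B : R) (Phi h : R -> R) (f : R -> R -> R).
Hypotheses (T_gt0 : 0 < T) (a_gt0 : 0 < a).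
Hypothesis Phi_cont : {within `[- a, a], continuous Phi}.
Hypothesis Phi_convex : forall x y, x \in `[- a, a] -> y \in `[- a, a] ->
  Phi ((x + y) / 2) <= (Phi x + Phi y) / 2.
Hypothesis f_cont : {within `[0, T] `*` [set: R], continuous (fun z : R * R => f z.1 z.2)}.
Hypotheses (B0 : 0 <= B) (fB : forall t s, t \in `[0, T] -> `|f t s| <= B).
Hypothesis h_cont : {within `[0, T], continuous h}.

Local Notation E g := (gradient_energy T Phi g).
Local Notation Ih v := (forcing T h v).
Local Notation IF v := (potential T f v).

Lemma lower_order_lipschitz : exists2 C, 0 <= C & forall u v d,
    {within `[0, T], continuous u} -> {within `[0, T], continuous v} ->
    (forall t, t \in `[0, T] -> `|u t - v t| <= d) ->
  `|(Ih u + IF u) - (Ih v + IF v)| <= C * d.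
Proof.
have [H H0 hH] := within_continuous_bounded h_cont.
exists ((H + B) * T); first by rewrite mulr_ge0 ?addr_ge0// ltW.
move=> u v d cu cv uvd.
have cFu := primitive_comp_continuous (ltW T_gt0) B0 f_cont fB cu.
have cFv := primitive_comp_continuous (ltW T_gt0) B0 f_cont fB cv.
have chu := within_continuousM h_cont cu.
have chv := within_continuousM h_cont cv.
rewrite /forcing /potential -!RintegralD_continuous// mulrAC.
apply: Rintegral_dist_le; [exact: ltW|exact: within_continuousD|exact: within_continuousD|].
move=> t tT; rewrite opprD addrACA (le_trans (ler_normD _ _))// mulrDl lerD//.
  by rewrite -mulrBr normrM ler_pM// ?hH ?uvd.
apply: (@le_trans _ _ (B * `|u t - v t|)); last by rewrite ler_wpM2l// uvd.
apply: primitive_lipschitz; first exact: joint_continuous_slice f_cont.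
by move=> s; exact: fB.
Qed.

(** The cluster point V of a minimizing sequence admits, for every r > 0, some g n as an
    approximate derivative whose energy is at most m - \int h V - \int F(t, V) + r,
    where m is the infimum; [weak_lower_semicontinuity] then gives a true derivative
    with r = 0. *)
Lemma bounded_minimum M :
    (exists v g, [/\ setK T a v, integral_rep T a v g & `|v 0| <= M]) ->
  exists v g, [/\ setK T a v, integral_rep T a v g & forall v' g',
    setK T a v' -> integral_rep T a v' g' -> `|v' 0| <= M ->
    E g + Ih v + IF v <= E g' + Ih v' + IF v'].
Proof.
move=> [v0 [g0 [v0K v0g v0M]]].
have [C C0 CP] := lower_order_lipschitz.
have [P P0 PP] := bounded_mfun_comp Phi_cont.
have zT : 0 \in `[0, T] by rewrite in_itv/= lexx ltW.
have TT : T \in `[0, T] by rewrite in_itv/= lexx ltW.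
have vM v g t : integral_rep T a v g -> `|v 0| <= M -> t \in `[0, T] -> `|v t| <= M + a * T.
  move=> vg vM tT; have := integral_rep_lipschitz vg zT tT.
  have : a * `|0 - t| <= a * T.
    rewrite ler_wpM2l ?(ltW a_gt0)// sub0r normrN.
    by have := tT; rewrite in_itv/= => /andP[t0 tT']; rewrite ger0_norm.
  have := lerB_dist (v t) (v 0); rewrite distrC; move: vM; lra.
have E_ge v g : integral_rep T a v g -> - (P * T) <= E g.
  case=> ga _ _ _; have [mPg Pg] := PP _ ga.
  have := @Rintegral_le_bound R `[0, T] (Phi \o g) P.
  rewrite lebesgue_measure_itv/= lte_fin T_gt0 /= subr0 => H.
  have : `|E g| <= P * T.
    by apply: H => //; [rewrite ltry|exact: measurable_funTS|move=> x _; exact: Pg].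
  by rewrite ler_norml => /andP[].
have c0 : {within `[0, T], continuous (fun=> 0 : R)} by exact: within_continuous_cst.
pose X := [set x | exists v g, [/\ setK T a v, integral_rep T a v g, `|v 0| <= M &
  x = E g + Ih v + IF v]].
have X0 : X !=set0 by exists (E g0 + Ih v0 + IF v0), v0, g0.
have infX : has_inf X.
  split => //; exists (- (P * T) + (Ih (fun=> 0) + IF (fun=> 0)) - C * (M + a * T)).
  move=> _ [v [g [vK vg vM0 ->]]].
  have cv := setK_continuous vK.
  have vd t : t \in `[0, T] -> `|v t - 0| <= M + a * T.
    by move=> tT; rewrite subr0; exact: vM vg vM0 tT.
  have := CP v (fun=> 0) _ cv c0 vd; rewrite ler_norml => /andP[+ _].
  have := E_ge v g vg.
  move: (P * T) (C * (M + a * T)) (E g) (Ih v) (IF v) (Ih (fun=> 0)) (IF (fun=> 0)).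
  by move=> *; lra.
pose m := inf X.
have /choice[F FP] : forall n : nat, exists p : (R -> R) * (R -> R),
    [/\ setK T a p.1, integral_rep T a p.1 p.2, `|p.1 0| <= M &
      E p.2 + Ih p.1 + IF p.1 < m + n.+1%:R^-1].
  move=> n; have [|x [v [g [vK vg vM0 ->]]] xm] := inf_adherent (_ : 0 < n.+1%:R^-1) infX.
    by rewrite invr_gt0 ltr0n.
  by exists (v, g).
pose v n := (F n).1; pose g n := (F n).2.
have vK n : setK T a (v n) by case: (FP n).
have vg n : integral_rep T a (v n) (g n) by case: (FP n).
have vM0 n : `|v n 0| <= M by case: (FP n).
have vm n : E (g n) + Ih (v n) + IF (v n) < m + n.+1%:R^-1 by case: (FP n).
have [V [VL VP]] := @uniform_cluster_lipschitz R T (M + a * T) a v (ltW a_gt0)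
  (fun n t => vM _ _ t (vg n) (vM0 n))
  (fun n s t => @integral_rep_lipschitz R T a (v n) (g n) s t (vg n)).
have cV : {within `[0, T], continuous V} by exact: lipschitz_within_continuous VL.
pose V1 t := V t - V 0.
have Cn0 r : 0 < r -> constrained a Phi V1 T (m - (Ih V + IF V)) r !=set0.
  move=> r0.
  pose d := r / 2 / (C + 1).
  have d0 : 0 < d by rewrite !divr_gt0// ltr_wpDl.
  pose d' := Num.min (r / 2) d.
  have d'0 : 0 < d' by rewrite lt_min d0 divr_gt0.
  have [n nN vnV] := VP d' d'0 (Num.truncn (r / 2)^-1).
  have nr : n.+1%:R^-1 <= r / 2.
    rewrite -[leRHS]invrK lef_pV2 ?posrE ?invr_gt0 ?divr_gt0//.
    by apply: ltW; rewrite (lt_le_trans (truncnS_gt _))// ler_nat ltnS.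
  have d'r : d' <= r / 2 by rewrite ge_min lexx.
  have Cd : C * d' <= r / 2.
    apply: (@le_trans _ _ (C * d)); first by rewrite ler_wpM2l// ge_min lexx orbT.
    by rewrite mulrCA ler_piMr ?divr_ge0 ?(ltW r0)// ler_pdivrMr ?ltr_wpDl// mul1r lerDl.
  have [ga vgE _ _] := vg n.
  exists (g n); split => //.
    have := CP _ _ _ (setK_continuous (vK n)) cV vnV; rewrite ler_norml => /andP[+ _].
    have := vm n; move: nr Cd.
    rewrite -/(gradient_energy T Phi (g n)).
    move: (gradient_energy _ _ _) (forcing _ _ (v n)) (potential _ _ (v n)) => e1 e2 e3.
    move: (forcing _ _ _) (potential _ _ _) (n.+1%:R^-1) (C * d') => e4 e5 e6 e7; lra.
  move=> t tT.
  have -> : indefinite (g n) t - V1 t = (v n t - V t) - (v n 0 - V 0).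
    by rewrite vgE// /V1; ring.
  apply: (le_trans (ler_normB _ _)).
  have := vnV t tT; have := vnV 0 zT; move: d'r; lra.
have [gV [gVa EgV gVV]] := weak_lower_semicontinuity T_gt0 Phi_cont Phi_convex Cn0.
have V0T : V T = V 0.
  apply/eqP; rewrite -subr_eq0 -normr_le0; apply/ler_addgt0Pl => e e0; rewrite addr0.
  have e20 : 0 < e / 2 by rewrite divr_gt0.
  have [n _ vnV] := VP _ e20 0%N.
  have vT : v n T = v n 0 by case: (vK n) => -[].
  have -> : V T - V 0 = (v n 0 - V 0) - (v n T - V T) by rewrite vT; ring.
  apply: (le_trans (ler_normB _ _)).
  have := vnV T TT; have := vnV 0 zT; lra.
have [VK Vg] : setK T a V /\ integral_rep T a V gV.
  apply: integral_setK => //; first exact: ltW.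
    by move=> t tT; rewrite gVV// /V1 addrC subrK.
  by rewrite gVV// /V1 V0T subrr.
exists V, gV; split; [exact: VK|exact: Vg|move=> v' g' v'K v'g v'M].
have mX : m <= E g' + Ih v' + IF v'.
  by apply: ge_inf; [case: infX|exists v', g'].
rewrite -/(gradient_energy T Phi gV) in EgV.
move: EgV mX; move: (gradient_energy _ _ gV) (gradient_energy _ _ g').
move: (forcing _ _ V) (potential _ _ V) (forcing _ _ v') (potential _ _ v').
by move=> *; lra.
Qed.

End DirectMethod.

Theorem corollary2p1 (R : realType) (T a : R) (Phi h : R -> R)
    (f : R -> R -> R) (alpha : R) (w : R -> R)
    (T_gt0 : 0 < T) (a_gt0 : 0 < a)
    (Phi_cont : {within `[- a, a], continuous Phi})
    (Phi_derivable : forall x, x \in `]- a, a[ -> derivable Phi x 1)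
    (Phi_C1 : {within `]- a, a[, continuous (derive1 Phi)})
    (phi_increasing :
       {in `]- a, a[ &, {homo derive1 Phi : x y / x < y}})
    (phi_homeo : homeomorphism_onto_R `]- a, a[ (derive1 Phi))
    (phi0 : derive1 Phi 0 = 0)
    (f_cont : {within `[0, T] `*` [set: R],
                continuous (fun z : R * R => f z.1 z.2)})
    (f_lim : lim_infty_unif T f 0)
    (F_lim : lim_infty_unif T (primitive f) alpha)
    (h_cont : {within `[0, T], continuous h})
    (h_mean0 : \int[@lebesgue_measure R]_(t in `[0, T]) h t = 0)
    (w_WK : (setW T `&` setK T a) w)
    (w_min : is_minimizer (functionalJ T a Phi h) (setW T) w)
    (F_le : exists v0 : R,
       \int[@lebesgue_measure R]_(t in `[0, T]) primitive f t (w t + v0)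
         <= alpha * T) :
  exists u : R -> R,
    is_minimizer (functionalI T a Phi h f) (W1inf_per T) u.
Proof.
have T0 := ltW T_gt0; have a0 := ltW a_gt0.
have Phi_convex := midpoint_convex Phi_cont Phi_derivable phi_increasing.
have [B B0 fB] := vanishing_bounded f_cont f_lim.
have [_ wK] := w_WK; have [gw wg] := setK_integral_rep T_gt0 a0 wK.
have [v0 Fv0] := F_le.
have [uK ug] := setK_shift v0 T_gt0 a0 wg.
set u := (fun t => w t + v0) in uK ug.
have IE v g := @functionalI_value R T a Phi h f B v g T0 B0 Phi_cont h_cont f_cont fB.
pose I_ v g := gradient_energy T Phi g + forcing T h v + potential T f v.
suff [v [g [vK vg vmin]]] : exists v g, [/\ setK T a v, integral_rep T a v g &
    forall v' g', setK T a v' -> integral_rep T a v' g' -> I_ v g <= I_ v' g'].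
  exists v; split; first by case: vK.
  move=> v' v'W; rewrite (IE v g vK vg).
  have [v'K|v'K] := pselect (setK T a v'); last first.
    by rewrite /functionalI asboolF// leey.
  have [g' v'g] := setK_integral_rep T_gt0 a0 v'K.
  by rewrite (IE v' g' v'K v'g) lee_fin; exact: vmin.
(* either u itself is a minimizer, or some v1 does strictly better *)
have [umin|/existsNP[v1 /existsNP[g1 /not_implyP[v1K /not_implyP[v1g /negP]]]]] :=
  pselect (forall v' g', setK T a v' -> integral_rep T a v' g' -> I_ u gw <= I_ v' g').
  by exists u, gw; split; [exact: uK|exact: ug|exact: umin].
rewrite -ltNge => v1u.
have e0 : 0 < I_ u gw - I_ v1 g1 by rewrite subr_gt0.
have [M coerc] :=
  coercivity T_gt0 a_gt0 Phi_cont f_cont B0 fB h_cont h_mean0 wK wg w_min F_lim e0.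
have far v g : setK T a v -> integral_rep T a v g -> M < `|v 0| -> I_ v1 g1 <= I_ v g.
  move=> vK vg /(coerc v g vK vg); apply: le_trans.
  rewrite opprB addrCA lerDl subr_ge0 /I_.
  by rewrite (forcing_shift h_cont h_mean0)// ?lerD2l//; exact: setK_continuous wK.
(* v1 has to be admissible for the minimization on a bounded set *)
pose M' := Num.max M `|v1 0|.
have [|v [g [vK vg vmin]]] :=
  bounded_minimum T_gt0 a_gt0 Phi_cont Phi_convex f_cont B0 fB h_cont (M := M').
  by exists v1, g1; split; [exact: v1K|exact: v1g|rewrite le_max lexx orbT].
exists v, g; split; [exact: vK|exact: vg|move=> v' g' v'K v'g].
have [v'M|] := leP `|v' 0| M'; first exact: vmin.
rewrite gt_max => /andP[Mv' _].
apply: le_trans (far _ _ v'K v'g Mv'); apply: vmin => //.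
by rewrite le_max lexx orbT.
Qed.
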